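(* Let $n\ge 1$, let $P\in\mathscr{P}_n$ with $P(z)\neq 0$ for $|z|<1$, and let $B\in\mathcal{B}_n$ with coefficients $\lambda_0,\lambda_1,\lambda_2$. Then for every real or complex number $\alpha$ with $|\alpha|\le 1$, all real $R>r\ge 1$ and all $0\le p<\infty$, writing $\sigma(z)=Rz$ and $\rho(z)=rz$, $$\left\|B[P\circ\sigma](z)-\alpha B[P\circ\rho](z)\right\|_p\le \frac{\left\|(R^n-\alpha r^n)\Lambda_n z+(1-\alpha)\lambda_0\right\|_p}{\|1+z\|_p}\,\|P(z)\|_p .$$ The result is best possible, and equality holds for $P(z)=az^n+b$ with $|a|=|b|\neq 0$.
   Context: $\mathscr{P}_n$ denotes the class of complex polynomials $P(z)=\sum_{j=0}^n a_jz^j$ of degree $n$. For a polynomial $P$, $\|P(z)\|_0:=\exp\left\{\frac1{2\pi}\int_0^{2\pi}\log|P(e^{i\theta})|\,d\theta\right\}$ and $\|P(z)\|_p:=\left\{\frac1{2\pi}\int_0^{2\pi}|P(e^{i\theta})|^p\,d\theta\right\}^{1/p}$ for $0<p<\infty$. $(P\circ\psi)(z):=P(\psi(z))$. $\mathcal{B}_n$ is the class of operators $B$ of the form $$B[P](z):=\lambda_0P(z)+\lambda_1\left(\frac{nz}{2}\right)\frac{P'(z)}{1!}+\lambda_2\left(\frac{nz}{2}\right)^2\frac{P''(z)}{2!},$$ where $\lambda_0,\lambda_1,\lambda_2\in\mathbb{C}$ are such that all the zeros of $u(z):=\lambda_0+\binom n1\lambda_1z+\binom n2\lambda_2z^2$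 lie in the half plane $|z|\le|z-n/2|$. $\Lambda_n:=\lambda_0+\lambda_1\frac{n^2}{2}+\lambda_2\frac{n^3(n-1)}{8}$. *)

(* Defs.v *)
From mathcomp Require Import all_boot all_order all_algebra.
From mathcomp Require Import all_classical all_reals all_analysis.
From mathcomp Require Export complex.
Set Implicit Arguments.
Unset Strict Implicit.
Unset Printing Implicit Defensive.
Import Order.TTheory GRing.Theory Num.Theory.
Local Open Scope classical_set_scope.
Local Open Scope ring_scope.
Local Open Scope complex_scope.

Definition cexpi (K : realType) (t : K) : K[i] := cos t +i* sin t.

(* The norm `|z| on K[i] is itself K[i]-valued, whereas normc z is the same
   modulus as an element of K. *)
Definition circ_abs (K : realType) (P : {poly K[i]}) (t : K) : K :=
  ComplexField.Normc.normc P.[cexpi t].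

(* In the case p = 0 the logarithm and the exponential are the extended ones,
   with lne 0 = -oo and expeR -oo = 0 (whereas ln 0 = 0); in particular
   pnorm 0 0 = 0.  The integrand is bounded above, so the argument of fine is
   never +oo. *)
Definition pnorm (K : realType) (p : K) (P : {poly K[i]}) : K :=
  if p == 0 then
    fine (expeR (((2 * pi)^-1)%:E *
      \int[lebesgue_measure]_(t in `[0%R, (2 * pi)%R]) lne (circ_abs P t)%:E))
  else
    ((2 * pi)^-1 *
      \int[lebesgue_measure]_(t in `[0%R, (2 * pi)%R]) (circ_abs P t `^ p))
    `^ p^-1.

Definition poly_deg (K : realType) (n : nat) (P : {poly K[i]}) : Prop :=
  size P = n.+1.

Definition zero_free_disc (K : realType) (P : {poly K[i]}) : Prop :=
  forall z : K[i], `|z| < 1 -> P.[z] != 0.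

Definition Bop (K : realType) (n : nat) (l0 l1 l2 : K[i]) (P : {poly K[i]}) :
    {poly K[i]} :=
  l0 *: P
  + l1 *: (((n%:R / 2) *: 'X) * ((1`!)%:R^-1 *: P^`()))
  + l2 *: (((n%:R / 2) *: 'X) ^+ 2 * ((2`!)%:R^-1 *: P^`(2))).

Definition upoly (K : realType) (n : nat) (l0 l1 l2 : K[i]) : {poly K[i]} :=
  l0%:P + ('C(n, 1)%:R * l1) *: 'X + ('C(n, 2)%:R * l2) *: 'X^2.

(* If upoly n l0 l1 l2 is the zero polynomial then every point is a zero of it,
   so this condition fails. *)
Definition Bclass (K : realType) (n : nat) (l0 l1 l2 : K[i]) : Prop :=
  forall z : K[i], root (upoly n l0 l1 l2) z -> `|z| <= `|z - n%:R / 2|.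

Definition Lam (K : realType) (n : nat) (l0 l1 l2 : K[i]) : K[i] :=
  l0 + l1 * (n%:R ^+ 2 / 2) + l2 * (n%:R ^+ 3 * (n%:R - 1) / 8).

Definition dilate (K : realType) (s : K) (P : {poly K[i]}) : {poly K[i]} :=
  P \Po (s%:C *: 'X).

Definition Bdiff (K : realType) (n : nat) (l0 l1 l2 alpha : K[i]) (R r : K)
    (P : {poly K[i]}) : {poly K[i]} :=
  Bop n l0 l1 l2 (dilate R P) - alpha *: Bop n l0 l1 l2 (dilate r P).

Definition sharp_const (K : realType) (n : nat) (l0 l1 l2 alpha : K[i])
    (R r p : K) : K :=
  pnorm p (((R%:C ^+ n - alpha * r%:C ^+ n) * Lam n l0 l1 l2) *: 'X
           + ((1 - alpha) * l0)%:P)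
  / pnorm p (1 + 'X).

(* Main.v *)
Require Import Defs.
From mathcomp Require Import all_boot all_order all_algebra.
From mathcomp Require Import all_classical all_reals all_analysis.
From mathcomp Require Import measurable_realfun ring lra.
Import Order.TTheory GRing.Theory Num.Theory.
Import numFieldNormedType.Exports.
Import ComplexField.Normc.
Local Open Scope ring_scope.

(**
The operator P |-> B[P(R .)] - alpha B[P(r .)] acts on a polynomial of degree
at most n coefficientwise: it multiplies the k-th coefficient by a number m_k
(Bdiff_mulop).  Such a multiplier is governed by its symbol, the image of
(1 + X)^n: by Grace's theorem (grace), if the symbol has no zero in the disc,
the multiplier maps polynomials without zeros in the disc to polynomials of the
same kind.

Let d be the dual multiplier, d_k = conj m_(n-k).  Its symbol has no zero in the
closed disc (symbol_Bdiff_zero_free): the hypothesis on the zeros of u says that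
the part coming from B is non-zero in the open disc, and the part coming from
the dilations is (R + z)^n - alpha (r + z)^n, where |R + z| > |r + z|.  On the
disc the reciprocal polynomial of a zero-free polynomial is smaller than the
polynomial itself (recip_lt).  Hence, for every unimodular mu, the combination
d + mu m again has a zero-free symbol (symbol_dual_comb).  Two facts follow.
If P has no zero in the disc, the image of P under m is at most its image under
d in modulus on the circle (mulop_dual_le).  And, for e = (d + mu m) / (d + mu
m)_0, the multiplier e does not increase any L^p mean of any polynomial of
degree at most n (power_mean_mulop, an instance of Arestov's theorem).

The latter is proved in three steps.  For the logarithmic mean, replace P by the
polynomial Q with the same modulus on the circle whose zeros are reflected out
of the disc (outer_part): the image of P is dominated on the circle by the image
of Q, which has no zero in the disc, so that by Jensen's formula (jensen) its
logarithmic mean is log |Q(0)|, the logarithmic mean of P.  Applying this to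
P + t e^{ig} and averaging over g replaces log by log max(., t)
(logmax_mean_mulop).  Finally u^p is a positive superposition of the functions
log max(u, t) (power_mean_of_logmax).

For p > 0, integrate the inequality for d + e^{ig} m over g and exchange the
integrals.  For fixed z on the circle, the mean over g of
|(d P)(z) + e^{ig} (m P)(z)|^p is at least |(m P)(z)|^p times the mean of
|1 + e^{ig}|^p, because |m P| <= |d P| there (dual_mean_ineq).  For p = 0 the
inequality is |m P| <= |d P| combined with Jensen's formula for d P.

For a X^n + b with |a| = |b| both sides are means of binomials, which depend
only on the moduli of the two coefficients (pnorm_binomial_scale); so equality
holds, and X^n + 1 shows that the constant is optimal.
*)

Set Implicit Arguments.
Unset Strict Implicit.
Unset Printing Implicit Defensive.

(** * Polynomials without zeros in the disc, Grace's theorem and multipliers *)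

Section DiscPolynomials.
Variable C : numClosedFieldType.
Implicit Types (F G V : {poly C}) (z w : C) (n : nat) (d : nat -> C).

Definition zero_free_open F := forall z, `|z| < 1 -> F.[z] != 0.
Definition zero_free_closed F := forall z, `|z| <= 1 -> F.[z] != 0.

Lemma zero_free_closed_open F : zero_free_closed F -> zero_free_open F.
Proof. by move=> h z /ltW; apply: h. Qed.

(** The induction scheme used below: n bounds the degree, and the zeros of a
    polynomial of lower degree are thought of as lying at infinity. *)
Lemma poly_const_or_root n F : (size F <= n.+1)%N ->
  (exists c, F = c%:P) \/
  exists m w G, [/\ n = m.+1, (size G <= m.+1)%N & F = G * ('X - w%:P)].
Proof.
move=> sF; have [s1|s1] := leqP (size F) 1.
  by left; exists F`_0; apply: size1_polyC.
right; have /closed_rootP[w /factor_theorem[G eF]] : size F != 1%N.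
  by rewrite neq_ltn s1 orbT.
have G0 : G != 0 by apply: contraTneq s1 => G0; rewrite eF G0 mul0r size_poly0.
case: n sF => [|m] sF; first by rewrite leqNgt s1 in sF.
exists m, w, G; split=> //.
by move: sF; rewrite eF size_Mmonic ?monicXsubC// size_XsubC addn2.
Qed.

Lemma blaschke_sqr z w :
  `|1 - z^* * w| ^+ 2 - `|z - w| ^+ 2 = (1 - `|z| ^+ 2) * (1 - `|w| ^+ 2).
Proof. rewrite !normCK !rmorphB !rmorphM !rmorph1 /=. rewrite !conjCK; ring. Qed.

Lemma blaschke_le z w : `|z| <= 1 -> 1 <= `|w| -> `|1 - z^* * w| <= `|z - w|.
Proof.
move=> z1 w1; rewrite -(ler_pXn2r (n := 2)) ?nnegrE// -subr_le0 blaschke_sqr.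
by rewrite mulr_ge0_le0// ?subr_ge0 ?subr_le0 ?exprn_ile1 ?exprn_ege1.
Qed.

Lemma blaschke_lt z w : `|z| < 1 -> 1 < `|w| -> `|1 - z^* * w| < `|z - w|.
Proof.
move=> z1 w1; rewrite -(ltr_pXn2r (n := 2)) ?nnegrE// -subr_lt0 blaschke_sqr.
by rewrite pmulr_rlt0 ?subr_gt0 ?subr_lt0 ?exprn_ilt1 ?exprn_egt1.
Qed.

Lemma blaschke_gt z w : `|z| < 1 -> `|w| < 1 -> `|z - w| < `|1 - z^* * w|.
Proof.
move=> z1 w1; rewrite -(ltr_pXn2r (n := 2)) ?nnegrE// -subr_gt0 blaschke_sqr.
by rewrite mulr_gt0// subr_gt0 exprn_ilt1.
Qed.

Lemma blaschke_ge z w : `|z| <= 1 -> `|w| <= 1 -> `|z - w| <= `|1 - z^* * w|.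
Proof.
move=> z1 w1; rewrite -(ler_pXn2r (n := 2)) ?nnegrE// -subr_ge0 blaschke_sqr.
by rewrite mulr_ge0// subr_ge0 exprn_ile1.
Qed.

Lemma blaschke_eq z w : `|z| = 1 -> `|1 - z^* * w| = `|z - w|.
Proof.
move=> z1; apply/eqP; rewrite -(eqrXn2 (n := 2))//; apply/eqP.
by apply/subr0_eq; rewrite blaschke_sqr z1 expr1n subrr mul0r.
Qed.

Lemma zero_free_open_factor F w : zero_free_open (F * ('X - w%:P)) -> zero_free_open F /\ 1 <= `|w|.
Proof.
move=> h; split.
  by move=> z /h; rewrite hornerM mulf_eq0 negb_or => /andP[].
rewrite real_leNgt ?realE//; last by rewrite normr_ge0.
  by apply/negP => /h; rewrite hornerM !hornerE subrr mulr0 eqxx.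
by rewrite ler01.
Qed.

Lemma zero_free_closed_factor F w : zero_free_closed (F * ('X - w%:P)) -> zero_free_closed F /\ 1 < `|w|.
Proof.
move=> h; split.
  by move=> z /h; rewrite hornerM mulf_eq0 negb_or => /andP[].
rewrite real_ltNge ?realE//; last by rewrite normr_ge0.
  by apply/negP => /h; rewrite hornerM !hornerE subrr mulr0 eqxx.
by rewrite ler01.
Qed.

(** A zero w with |w| >= 1 contributes to F'/F at z the number 1/(z - w), which
    lies in the closed disc of centre - conj z / (1 - |z|^2) and radius
    1 / (1 - |z|^2).  This disc contains 0, the contribution of a zero at
    infinity, and it is convex; so it contains the mean of n contributions. *)
Lemma zero_free_open_deriv n F z : (size F <= n.+1)%N -> zero_free_open F -> `|z| < 1 ->
  `|(1 - `|z| ^+ 2) * F^`().[z] + n%:R * z^* * F.[z]| <= n%:R * `|F.[z]|.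
Proof.
move=> sF hF z1; elim: n F sF hF => [|n IH] F sF hF.
  have /size1_polyC-> := sF.
  by rewrite derivC horner0 mulr0 !mul0r addr0 normr0.
have [[c ->]|[m [w [G [/eqP + sG eF]]]]] := poly_const_or_root sF.
  rewrite derivC horner0 mulr0 add0r !normrM normr_nat norm_conjC.
  by rewrite ler_wpM2r// ler_piMr ?ler0n// ltW.
rewrite eqSS => /eqP nm; rewrite -{m}nm in sG.
move: hF; rewrite eF => /zero_free_open_factor[hG w1].
rewrite derivM derivXsubC mulr1 hornerD !hornerM hornerXsubC.
have -> : (1 - `|z| ^+ 2) * (G^`().[z] * (z - w) + G.[z]) +
   n.+1%:R * z^* * (G.[z] * (z - w)) =
   (z - w) * ((1 - `|z| ^+ 2) * G^`().[z] + n%:R * z^* * G.[z]) +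
   G.[z] * (1 - z^* * w).
  rewrite normCK; ring.
apply: le_trans (ler_normD _ _) _; rewrite !normrM.
apply: le_trans (lerD (ler_wpM2l (normr_ge0 _) (IH _ sG hG))
  (ler_wpM2l (normr_ge0 _) (blaschke_le (ltW z1) w1))) _.
by rewrite -natr1 le_eqVlt; apply/orP; left; apply/eqP; ring.
Qed.

(** Laguerre's theorem on polar derivatives: if this polar derivative vanished,
    the previous bound would force |1 - conj z zeta| <= |z - zeta|, which fails
    when both points are in the open disc. *)
Lemma laguerre n F z zeta : (size F <= n.+2)%N -> zero_free_open F -> `|z| < 1 ->
  `|zeta| < 1 -> n.+1%:R * F.[z] + (zeta - z) * F^`().[z] != 0.
Proof.
move=> sF hF z1 ze1; apply/eqP => D0.
have hE := zero_free_open_deriv sF hF z1.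
set E := (X in `|X|) in hE.
have eE : (zeta - z) * E = - (n.+1%:R * F.[z] * (1 - z^* * zeta)).
  have eD : (zeta - z) * F^`().[z] = - (n.+1%:R * F.[z]).
    by apply/eqP; rewrite -addr_eq0 addrC D0.
  rewrite /E mulrDr mulrCA eD normCK; ring.
have F0 : 0 < n.+1%:R * `|F.[z]| by rewrite mulr_gt0 ?ltr0n// normr_gt0 hF.
have := ler_wpM2l (normr_ge0 (zeta - z)) hE.
rewrite -normrM eE normrN 2!normrM normr_nat [leRHS]mulrC ler_pM2l//.
by rewrite [`|zeta - z|]distrC => /le_lt_trans/(_ (blaschke_gt z1 ze1)); rewrite ltxx.
Qed.

(** The bilinear form of apolarity theory: pairing F with (1 + y X)^n evaluates
    F at y. *)
Definition apolar n V F : C := \sum_(k < n.+1) V`_k * F`_k / 'C(n, k)%:R.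

(** Grace's theorem.  Removing a root w of V turns the form of degree n.+1 into
    the form of degree n applied to a polar derivative of F at - 1/w, a point of
    the disc, so that Laguerre's theorem allows an induction. *)
Lemma grace n V F : (size V <= n.+1)%N -> (size F <= n.+1)%N ->
  zero_free_closed V -> zero_free_open F -> apolar n V F != 0.
Proof.
elim: n V F => [|n IH] V F sV sF hV hF.
  rewrite /apolar big_ord1 bin0 divr1 mulf_neq0//.
    by have := hV 0; rewrite normr0 ler01 horner_coef0; apply.
  by have := hF 0; rewrite normr0 ltr01 horner_coef0; apply.
have [[c eV]|[m [w [G [/eqP + sG eV]]]]] := poly_const_or_root sV.
  rewrite /apolar big_ord_recl big1 ?addr0; last first.
    by move=> i _; rewrite eV coefC lift0 !mul0r.
  rewrite bin0 divr1 mulf_neq0//.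
    by have := hV 0; rewrite normr0 ler01 horner_coef0; apply.
  by have := hF 0; rewrite normr0 ltr01 horner_coef0; apply.
rewrite eqSS => /eqP nm; rewrite -{m}nm in sG.
move: hV; rewrite eV => /zero_free_closed_factor[hG w1].
(* - w times the polar derivative of F at - 1/w *)
pose F1 := F^`() - w *: (n.+1%:R *: F - 'X * F^`()).
have w0 : w != 0 by rewrite -normr_gt0 (lt_trans _ w1).
have hF1 : zero_free_open F1.
  move=> z z1; rewrite /F1 !hornerE.
  have := @laguerre n F z (- w^-1) sF hF z1.
  rewrite normrN normfV invf_lt1 ?(lt_trans ltr01)// => /(_ w1).
  apply: contra_neq => h; apply: (mulfI (x := - w)); first by rewrite oppr_eq0.
  by rewrite mulr0 -h; field.
have cF1 k : F1`_k = F`_k.+1 *+ k.+1 - w * (n.+1%:R * F`_k - k%:R * F`_k).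
  rewrite coefB coefZ coefB coefZ coefXM !coef_deriv.
  by case: k => [|k]; rewrite ?mul0r /= ?[_.+1%:R * F`__.+1]mulr_natl ?mulr_natl ?mulr0n.
have sF1 : (size F1 <= n.+1)%N.
  apply/leq_sizeP => j nj; rewrite cF1 (leq_sizeP _ _ sF j.+1)// mul0rn sub0r.
  case: (ltngtP n.+1 j) nj => // [nj|<-] _; last by rewrite subrr mulr0 oppr0.
  by rewrite (leq_sizeP _ _ sF j)// !mulr0 subrr mulr0 oppr0.
have -> : apolar n.+1 (G * ('X - w%:P)) F = n.+1%:R^-1 * apolar n G F1.
  rewrite /apolar mulr_sumr.
  transitivity (\sum_(k < n.+1) G`_k * (F`_k.+1 / 'C(n.+1, k.+1)%:R)
     - \sum_(k < n.+1) G`_k * (w * F`_k / 'C(n.+1, k)%:R)).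
    under eq_bigr do rewrite mulrBr coefB coefMX coefMC 2!mulrBl.
    rewrite sumrB; congr (_ - _).
      by rewrite big_ord_recl /= !mul0r add0r; apply: eq_bigr => i _; rewrite mulrA.
    rewrite big_ord_recr /= (leq_sizeP _ _ sG n.+1)// !mul0r addr0.
    by apply: eq_bigr => i _; ring.
  rewrite -sumrB; apply: eq_bigr => k _.
  have kn : (k <= n)%N by rewrite -ltnS.
  have c0 m' j : (j <= m')%N -> ('C(m', j)%:R : C) != 0.
    by move=> jm; rewrite pnatr_eq0 -lt0n bin_gt0.
  rewrite cF1.
  have e1 : ('C(n.+1, k.+1)%:R : C) = n.+1%:R * 'C(n, k)%:R / k.+1%:R.
    apply: (mulIf (x := k.+1%:R)); first by rewrite pnatr_eq0.
    by rewrite divfK ?pnatr_eq0// -!natrM mul_bin_diag mulnC.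
  have e2 : ('C(n.+1, k)%:R : C) = n.+1%:R * 'C(n, k)%:R / (n.+1 - k)%:R.
    have p : ((n.+1 - k)%:R : C) != 0 by rewrite pnatr_eq0 subn_eq0 -ltnNge ltnS.
    apply: (mulIf p); rewrite divfK// -!natrM mulnC.
    by rewrite -(mul_bin_down n.+1 k).
  have h := c0 _ _ kn.
  rewrite e1 e2 subSn// -mulr_natl -!natr1 natrB//.
  have hn : (n%:R + 1 : C) != 0 by rewrite natr1 pnatr_eq0.
  have hk : (k%:R + 1 : C) != 0 by rewrite natr1 pnatr_eq0.
  have hk' : (n%:R - k%:R + 1 : C) != 0 by rewrite -natrB// natr1 pnatr_eq0.
  by field; rewrite ?hn ?hk ?hk' ?h.
by rewrite mulf_neq0 ?invr_eq0 ?pnatr_eq0// IH.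
Qed.


(** The coefficients of z^n times the conjugate of F at 1 / conj z; the degree n
    is a parameter because F may have lower degree. *)
Definition recip n F : {poly C} := \poly_(k < n.+1) (F`_(n - k))^*.

Lemma recipC n (c : C) : recip n c%:P = c^* *: 'X^n.
Proof.
apply/polyP => k; rewrite coef_poly coefZ coefXn coefC ltnS.
case: (ltngtP k n) => [kn|kn|->].
- by rewrite subn_eq0 leqNgt kn rmorph0 mulr0.
- by rewrite mulr0.
by rewrite subnn eqxx mulr1.
Qed.

Lemma recip_factor n G w : (size G <= n.+1)%N ->
  recip n.+1 (G * ('X - w%:P)) = recip n G * (1 - w^* *: 'X).
Proof.
move=> sG; apply/polyP => k.
rewrite [in RHS]mulrBr mulr1 coefB -scalerAr coefZ coefMX !coef_poly mulrBr.
rewrite coefB coefMX coefMC !ltnS.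
case: k => [|k] /=.
  by rewrite !subn0 /= (leq_sizeP _ _ sG n.+1)// mul0r subr0 mulr0 subr0.
rewrite !ltnS subSS; case: (ltngtP k n) => [kn|kn|->].
- by rewrite subn_eq0 leqNgt kn /= rmorphB rmorphM -subnS mulrC.
- by rewrite mulr0 subrr.
by rewrite subnn /= sub0r rmorphN rmorphM mulrC sub0r.
Qed.

Lemma norm_reflected_factor w z :
  `|(1 - w^* *: 'X).[z]| = `|1 - z^* * w|.
Proof.
rewrite hornerD hornerN hornerC hornerZ hornerX.
by rewrite -[LHS]norm_conjC rmorphB rmorphM rmorph1 /= conjCK mulrC.
Qed.

Lemma recip_le n V x : (size V <= n.+1)%N -> zero_free_closed V -> `|x| < 1 ->
  `|(recip n V).[x]| <= `|V.[x]|.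
Proof.
move=> + + x1; elim: n V => [|n IH] V sV hV.
  by have /size1_polyC-> := sV; rewrite recipC expr0 alg_polyC !hornerC norm_conjC.
have [[c ->]|[m [w [G [/eqP + sG eV]]]]] := poly_const_or_root sV.
  rewrite recipC hornerZ hornerXn hornerC normrM norm_conjC ler_piMr//.
  by rewrite normrX exprn_ile1// ltW.
rewrite eqSS => /eqP nm; rewrite -{m}nm in sG.
move: hV; rewrite eV => /zero_free_closed_factor[hG w1].
rewrite recip_factor// !hornerM !normrM ler_pM ?IH//.
by rewrite norm_reflected_factor hornerXsubC blaschke_le// ltW.
Qed.

(** Strictness comes from any one of the n factors: X - w with |w| > 1 exceeds
    its reflection inside the disc, and a missing factor is reflected to X. *)
Lemma recip_lt n V x : (0 < n)%N -> (size V <= n.+1)%N -> zero_free_closed V ->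
  `|x| < 1 -> `|(recip n V).[x]| < `|V.[x]|.
Proof.
case: n => // n _ sV hV x1.
have [[c eV]|[m [w [G [/eqP + sG eV]]]]] := poly_const_or_root sV.
  rewrite eV recipC hornerZ hornerXn hornerC normrM norm_conjC gtr_pMr//.
    by rewrite normrX exprn_ilt1.
  by rewrite normr_gt0; have := hV 0; rewrite eV hornerC normr0 ler01; apply.
rewrite eqSS => /eqP nm; rewrite -{m}nm in sG.
move: hV; rewrite eV => /zero_free_closed_factor[hG w1].
rewrite recip_factor// !hornerM !normrM.
apply: le_lt_trans (ler_wpM2r (normr_ge0 _) (recip_le sG hG x1)) _.
rewrite ltr_pM2l ?normr_gt0 ?hG ?(ltW x1)//.
rewrite norm_reflected_factor hornerXsubC.
exact: blaschke_lt.
Qed.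

Definition mulop n d F : {poly C} := \poly_(k < n.+1) (d k * F`_k).
(** The image of (1 + X)^n under the multiplier d. *)
Definition symbol n d : {poly C} := \poly_(k < n.+1) ('C(n, k)%:R * d k).

Lemma size_mulop n d F : (size (mulop n d F) <= n.+1)%N.
Proof. exact: size_poly. Qed.

Lemma mulopD n d F G : mulop n d (F + G) = mulop n d F + mulop n d G.
Proof.
apply/polyP => k; rewrite coefD !coef_poly; case: ifP => _; last by rewrite addr0.
by rewrite coefD mulrDr.
Qed.

Lemma mulopZ n d a F : mulop n d (a *: F) = a *: mulop n d F.
Proof.
apply/polyP => k; rewrite coefZ !coef_poly; case: ifP => _; last by rewrite mulr0.
by rewrite coefZ mulrCA.
Qed.

Lemma mulopC n d a : mulop n d a%:P = (d 0%N * a)%:P.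
Proof.
apply/polyP => -[|k]; rewrite coef_poly !coefC//= mulr0.
by case: ifP.
Qed.

Lemma horner_mulop0 n d F : (mulop n d F).[0] = d 0%N * F.[0].
Proof. by rewrite !horner_coef0 coef_poly. Qed.

Lemma mulop_addl n d e (mu : C) F :
  mulop n (fun k => d k + mu * e k) F = mulop n d F + mu *: mulop n e F.
Proof.
apply/polyP => k; rewrite coefD coefZ !coef_poly; case: ifP => _.
  by rewrite mulrDl mulrA.
by rewrite mulr0 addr0.
Qed.

(** This identity is what makes Grace's theorem a statement on multipliers. *)
Lemma horner_mulop n d F z : (size F <= n.+1)%N ->
  (mulop n d F).[z] = apolar n (symbol n d) (F \Po (z *: 'X)).
Proof.
move=> sF; rewrite horner_poly; apply: eq_bigr => k _.
rewrite coef_poly ltn_ord.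
have -> : (F \Po (z *: 'X))`_k = F`_k * z ^+ k.
  by rewrite comp_polyE; under eq_bigr do rewrite exprZn scalerA;
     rewrite -(poly_def (size F) (fun i => F`_i * z ^+ i)) coef_poly;
     case: ltnP => // h; rewrite nth_default// mul0r.
rewrite -!mulrA [RHS]mulrC -!mulrA mulVf ?mulr1//.
by rewrite pnatr_eq0 -lt0n bin_gt0 -ltnS.
Qed.

Lemma size_comp_scale n F z : (size F <= n.+1)%N ->
  (size (F \Po (z *: 'X)) <= n.+1)%N.
Proof.
move=> sF; apply: leq_trans (size_comp_poly_leq _ _) _; rewrite ltnS.
have h : ((size (z *: 'X : {poly C})).-1 <= 1)%N.
  by rewrite -subn1 leq_subLR (leq_trans (size_scale_leq _ _))// size_polyX.
apply: leq_trans (leq_mul (leqnn _) h) _.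
by rewrite muln1 -subn1 leq_subLR add1n.
Qed.

Lemma mulop_zero_free_closed n d F : zero_free_closed (symbol n d) -> (size F <= n.+1)%N ->
  zero_free_open F -> zero_free_closed (mulop n d F).
Proof.
move=> hd sF hF z z1; rewrite horner_mulop//.
apply: grace => //; [exact: size_poly|exact: size_comp_scale|].
move=> x x1; rewrite horner_comp; apply: hF.
by rewrite !hornerE normrM (le_lt_trans _ x1)// ler_piMl.
Qed.

Lemma apolarC n F G : apolar n F G = apolar n G F.
Proof. by apply: eq_bigr => k _; rewrite [F`_k * _]mulrC. Qed.

Lemma mulop_zero_free_open n d F : zero_free_open (symbol n d) -> (size F <= n.+1)%N ->
  zero_free_open F -> zero_free_open (mulop n d F).
Proof.
move=> hd sF hF z z1; rewrite horner_mulop// apolarC.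
apply: grace => //; [exact: size_comp_scale|exact: size_poly|].
move=> x x1; rewrite horner_comp; apply: hF.
by rewrite !hornerE normrM (le_lt_trans _ z1)// ler_piMr.
Qed.

Lemma mulop_zero_free_closed_arg n d F : zero_free_open (symbol n d) -> (size F <= n.+1)%N ->
  zero_free_closed F -> zero_free_closed (mulop n d F).
Proof.
move=> hd sF hF z z1; rewrite horner_mulop// apolarC.
apply: grace => //; [exact: size_comp_scale|exact: size_poly|].
move=> x x1; rewrite horner_comp; apply: hF.
by rewrite !hornerE normrM mulr_ile1.
Qed.

Lemma poly_lipschitz F z : `|z| <= 1 -> exists2 K : C, 0 <= K &
  forall y, `|y| <= 1 -> `|F.[z] - F.[y]| <= K * `|z - y|.
Proof.
move=> z1; have /factor_theorem[q eq] : root (F - F.[z]%:P) z.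
  by rewrite rootE !hornerE subrr.
exists (\sum_(k < size q) `|q`_k|); first by rewrite sumr_ge0.
move=> y y1; rewrite distrC.
have -> : F.[y] - F.[z] = (F - F.[z]%:P).[y] by rewrite !hornerE.
rewrite eq hornerM normrM hornerXsubC distrC ler_wpM2r// horner_coef.
apply: le_trans (ler_norm_sum _ _ _) _; apply: ler_sum => k _.
by rewrite normrM ler_piMr// normrX exprn_ile1.
Qed.

(** Compare at the points (1 - t) z with t tending to 0. *)
Lemma disc_le_closure F G : (forall z, `|z| < 1 -> `|F.[z]| <= `|G.[z]|) ->
  forall z, `|z| <= 1 -> `|F.[z]| <= `|G.[z]|.
Proof.
move=> h z z1; rewrite real_leNgt ?normr_real//; apply/negP => lt.
have [K1 K10 h1] := poly_lipschitz F z1.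
have [K2 K20 h2] := poly_lipschitz G z1.
set e := `|F.[z]| - `|G.[z]|.
have e0 : 0 < e by rewrite subr_gt0.
(* t is small enough for both Lipschitz errors to stay below the gap e *)
have s0 : 0 < e + (K1 + K2) + 1 by rewrite ltr_wpDl// addr_ge0 ?(ltW e0)// addr_ge0.
pose t := e / (e + (K1 + K2) + 1).
have t0 : 0 < t by rewrite divr_gt0.
have t1 : t <= 1 by rewrite ler_pdivrMr// mul1r -addrA lerDl addr_ge0// addr_ge0.
have tK : t * (K1 + K2) < e.
  rewrite mulrAC ltr_pdivrMr// ltr_pM2l// -addrA ltr_wpDl ?(ltW e0)//.
  by rewrite ltrDl.
pose y := (1 - t) * z.
have ny : `|1 - t| = 1 - t by rewrite ger0_norm// subr_ge0.
have y1 : `|y| < 1.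
  rewrite normrM ny (@le_lt_trans _ _ (1 - t))// ?ler_piMr ?subr_ge0//.
  by rewrite ltrBlDr ltrDl.
have zy : `|z - y| <= t.
  rewrite /y mulrBl mul1r opprB addrC subrK normrM gtr0_norm// ler_piMr//.
  exact: ltW.
have : e <= t * (K1 + K2).
  rewrite /e lerBlDr mulrDr.
  have eF : F.[z] = (F.[z] - F.[y]) + F.[y] by rewrite subrK.
  rewrite eF; apply: le_trans (ler_normD _ _) _; rewrite -addrA lerD//.
    apply: le_trans (h1 _ (ltW y1)) _.
    by rewrite mulrC ler_wpM2r.
  apply: le_trans (h _ y1) _.
  have -> : G.[y] = G.[z] - (G.[z] - G.[y]) by rewrite subKr.
  apply: le_trans (ler_normB _ _) _; rewrite [leRHS]addrC lerD2l.
  apply: le_trans (h2 _ (ltW y1)) _.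
  by rewrite mulrC ler_wpM2r.
by move=> /le_lt_trans/(_ tK); rewrite ltxx.
Qed.

(** De Bruijn's argument: F - a G has no zero in the disc when |a| > 1, hence
    neither has its image, so the image of F is never a times the image of G. *)
Lemma mulop_le n d F G : zero_free_open (symbol n d) ->
  (size F <= n.+1)%N -> (size G <= n.+1)%N -> zero_free_open G ->
  (forall z, `|z| < 1 -> `|F.[z]| <= `|G.[z]|) ->
  forall z, `|z| <= 1 -> `|(mulop n d F).[z]| <= `|(mulop n d G).[z]|.
Proof.
move=> hd sF sG hG hFG; apply: disc_le_closure => z z1.
have G0 := mulop_zero_free_open hd sG hG z1.
rewrite real_leNgt ?normr_real//; apply/negP => lt.
pose a := (mulop n d F).[z] / (mulop n d G).[z].
have a1 : 1 < `|a| by rewrite normf_div ltr_pdivlMr ?mul1r// normr_gt0.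
have : zero_free_open (F + (- a) *: G).
  move=> x x1; rewrite hornerD hornerZ mulNr subr_eq0; apply: contraTneq (hFG _ x1) => ->.
  have aG : `|a| * `|G.[x]| \is Num.real by rewrite -normrM normr_real.
  rewrite normrM -real_ltNge ?aG ?normr_real//.
  by rewrite ltr_pMl// normr_gt0 hG.
have sFG : (size (F + (- a) *: G)%R <= n.+1)%N.
  rewrite (leq_trans (size_polyD _ _))// geq_max sF.
  by rewrite (leq_trans (size_scale_leq _ _)).
move=> /(mulop_zero_free_open hd sFG)/(_ _ z1).
by rewrite mulopD mulopZ hornerD hornerZ mulNr /a divfK// subrr eqxx.
Qed.

(** The zeros lying inside the disc are reflected in the circle. *)
Lemma outer_part n F : (size F <= n.+1)%N -> F != 0 ->
  exists G, [/\ (size G <= n.+1)%N, zero_free_open G,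
    forall z, `|z| <= 1 -> `|F.[z]| <= `|G.[z]| &
    forall z, `|z| = 1 -> `|F.[z]| = `|G.[z]|].
Proof.
elim: n F => [|n IH] F sF F0; have [[c eF]|] := poly_const_or_root sF.
- exists F; split=> // z z1; rewrite eF hornerC.
  by apply: contraNneq F0 => c0; rewrite eF c0.
- by case=> m [w [G []]].
- exists F; split=> // z z1; rewrite eF hornerC.
  by apply: contraNneq F0 => c0; rewrite eF c0.
move=> [m [w [G [/eqP + sG eF]]]].
rewrite eqSS => /eqP nm; rewrite -{m}nm in sG.
have G0 : G != 0 by apply: contraNneq F0 => G0; rewrite eF G0 mul0r.
have [H [sH hH le_H eq_H]] := IH _ sG G0.
have [w1|w1] := boolP (`|w| < 1); last first.
  exists (H * ('X - w%:P)); split.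
  - rewrite (leq_trans (size_polyMleq _ _))// size_XsubC addn2//.
  - move=> z z1; rewrite hornerM mulf_neq0 ?hH// hornerXsubC subr_eq0.
    by apply: contraNneq w1 => <-.
  - by move=> z z1; rewrite eF !hornerM !normrM ler_wpM2r// le_H.
  - by move=> z z1; rewrite eF !hornerM !normrM eq_H.
have eL := norm_reflected_factor w.
exists (H * (1 - w^* *: 'X)); split.
- rewrite (leq_trans (size_polyMleq _ _))//.
  have h2 : (size (1 - w^* *: 'X : {poly C})%R <= 2)%N.
    rewrite (leq_trans (size_polyD _ _))// geq_max size_poly1 size_polyN.
    by rewrite (leq_trans (size_scale_leq _ _))// size_polyX.
  rewrite -subn1 leq_subLR add1n (leq_trans (leq_add sH h2))// addn2//.
- move=> z z1; rewrite hornerM mulf_neq0 ?hH// -normr_gt0 eL.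
  by rewrite (le_lt_trans _ (blaschke_gt z1 w1)).
- move=> z z1; rewrite eF !hornerM !normrM eL ler_pM ?le_H// hornerXsubC.
  by rewrite blaschke_ge// ltW.
- by move=> z z1; rewrite eF !hornerM !normrM eL eq_H// hornerXsubC blaschke_eq.
Qed.

(** The multiplier obtained from d by conjugating with recip n. *)
Definition dual n d k : C := (d (n - k)%N)^*.

Lemma symbol_dual n d : symbol n (dual n d) = recip n (symbol n d).
Proof.
apply/polyP => k; rewrite !coef_poly; case: ifP => // kn.
rewrite ltnS leq_subr rmorphM rmorph_nat -bin_sub ?leq_subr//.
Qed.

(** The symbol is the sum of the symbol of d and of mu times its reciprocal
    polynomial, which is strictly smaller in the open disc. *)
Lemma symbol_dual_comb n d mu : (0 < n)%N -> zero_free_closed (symbol n d) -> `|mu| <= 1 ->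
  zero_free_open (symbol n (fun k => d k + mu * dual n d k)).
Proof.
move=> n0 hd mu1 z z1.
have -> : symbol n (fun k => d k + mu * dual n d k) =
    symbol n d + mu *: recip n (symbol n d).
  rewrite -symbol_dual; apply/polyP => k; rewrite coefD coefZ !coef_poly.
  by case: ifP => _; rewrite ?mulr0 ?addr0// mulrDr mulrCA.
rewrite !hornerE addrC addr_eq0.
have lt := recip_lt n0 (size_poly _ _ : (size (symbol n d) <= n.+1)%N) hd z1.
apply: contraTneq lt => e; rewrite -real_leNgt ?normr_real//.
by rewrite -[X in X <= _]normrN -e normrM ler_piMl.
Qed.

(** If the image under dual n d were larger at some z, a combination
    d + mu (dual n d) with |mu| <= 1 would map F to a polynomial vanishing
    at z. *)
Lemma mulop_dual_le n d F z : (0 < n)%N -> zero_free_closed (symbol n d) ->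
  (size F <= n.+1)%N -> zero_free_open F -> `|z| <= 1 ->
  `|(mulop n (dual n d) F).[z]| <= `|(mulop n d F).[z]|.
Proof.
move=> n0 hd sF hF; apply: disc_le_closure z => z z1.
have h mu : `|mu| <= 1 -> (mulop n d F).[z] + mu * (mulop n (dual n d) F).[z] != 0.
  move=> mu1; have := mulop_zero_free_open (symbol_dual_comb n0 hd mu1) sF hF z1.
  by rewrite mulop_addl hornerD hornerZ.
rewrite real_leNgt ?normr_real//; apply/negP => lt.
have T0 : (mulop n (dual n d) F).[z] != 0 by rewrite -normr_gt0 (le_lt_trans _ lt).
have := h (- ((mulop n d F).[z] / (mulop n (dual n d) F).[z])).
rewrite normrN normf_div ler_pdivrMr ?normr_gt0// mul1r (ltW lt) => /(_ isT).
by rewrite mulNr divfK// subrr eqxx.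
Qed.

End DiscPolynomials.

Local Open Scope classical_set_scope.
Local Open Scope ring_scope.
Local Open Scope complex_scope.

(** * Modulus and exponential on the unit circle *)

Section ComplexModulus.
Variable K : realType.
Implicit Types (z w : K[i]) (t : K) (F : {poly K[i]}).

Lemma normE z : `|z| = (normc z)%:C.
Proof. by []. Qed.

Lemma normc_ge0 z : 0 <= normc z.
Proof. by case: z => a b; exact: sqrtr_ge0. Qed.

Lemma normc_eq0 z : (normc z == 0) = (z == 0).
Proof. by rewrite -(normr_eq0 z) normE (inj_eq (@complexI _)). Qed.

Lemma normc_gt0 z : (0 < normc z) = (z != 0).
Proof. by rewrite lt_neqAle normc_ge0 andbT eq_sym normc_eq0. Qed.

Lemma le_normc z w : (`|z| <= `|w|) = (normc z <= normc w).
Proof. by rewrite !normE lecR. Qed.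

Lemma lt_normc z w : (`|z| < `|w|) = (normc z < normc w).
Proof. by rewrite !normE ltcR. Qed.

Lemma normc_conj z : normc z^*%C = normc z.
Proof. by case: z => a b /=; rewrite sqrrN. Qed.

Lemma normcD_le z w : normc (z + w) <= normc z + normc w.
Proof. exact: le_normcD. Qed.

Lemma normc_real t : normc t%:C = `|t|.
Proof. by rewrite /= expr0n addr0 sqrtr_sqr. Qed.

Lemma normcX z n : normc (z ^+ n) = normc z ^+ n.
Proof. by elim: n => [|n IH]; rewrite ?expr0 ?normc1// !exprS normcM IH. Qed.

Lemma cexpiD s t : cexpi (s + t) = cexpi s * cexpi t.
Proof.
rewrite /cexpi cosD sinD; apply/eqP; rewrite eq_complex /=; apply/andP.
by split; apply/eqP; ring.
Qed.

Lemma cexpi0 : cexpi (0 : K) = 1.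
Proof. by rewrite /cexpi cos0 sin0. Qed.

Lemma cexpiN t : cexpi (- t) = (cexpi t)^*%C.
Proof. by rewrite /cexpi cosN sinN. Qed.

Lemma normc_cexpi t : normc (cexpi t) = 1.
Proof. by rewrite /cexpi /= cos2Dsin2 sqrtr1. Qed.

Lemma norm_cexpi t : `|cexpi t| = 1.
Proof. by rewrite normE normc_cexpi. Qed.

Lemma cexpi_mulrn t n : cexpi (n%:R * t) = cexpi t ^+ n.
Proof.
elim: n => [|n IH]; first by rewrite mul0r cexpi0.
by rewrite -natr1 mulrDl mul1r cexpiD IH exprSr.
Qed.

Lemma cexpi2pi : cexpi (2 * pi : K) = 1.
Proof. by rewrite /cexpi mulr_natl cos2pi sin2pi. Qed.

Lemma cexpiD2pi t : cexpi (t + 2 * pi) = cexpi t.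
Proof. by rewrite cexpiD cexpi2pi mulr1. Qed.

Lemma cexpi_surj z : normc z = 1 -> exists2 c, 0 <= c <= 2 * pi & cexpi c = z.
Proof.
case: z => a b /= n1.
have ab : a ^+ 2 + b ^+ 2 = 1.
  by rewrite -(sqr_sqrtr (_ : 0 <= a ^+ 2 + b ^+ 2)) ?addr_ge0 ?sqr_ge0// n1 expr1n.
have a1 : -1 <= a <= 1.
  by rewrite -ler_norml -(@ler_pXn2r _ 2)// ?nnegrE// expr1n real_normK ?num_real//;
     have := sqr_ge0 b; lra.
have c0 := acos_ge0 a1; have cp := acos_lepi a1.
have ca : cos (acos a) = a by rewrite acosK// in_itv.
have sa : sin (acos a) = `|b|.
  rewrite sin_acos// -(sqrtr_sqr b); congr Num.sqrt; lra.
have pi0 := @pi_ge0 K.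
have [b0|b0] := leP 0 b.
  exists (acos a); first by rewrite c0/=; lra.
  by rewrite /cexpi ca sa ger0_norm.
exists (2 * pi - acos a); first by apply/andP; split; lra.
rewrite addrC cexpiD2pi cexpiN /cexpi ca sa ltr0_norm//=.
by rewrite opprK.
Qed.

(** After a rotation of the circle the two coefficients may be replaced by their
    moduli. *)
Lemma normc_polar A B : exists2 c, 0 <= c <= 2 * pi &
  forall t, normc (A + cexpi (t + c) * B) =
            normc ((normc A)%:C + cexpi t * (normc B)%:C).
Proof.
have pi0 := @pi_ge0 K.
have [->|A0] := eqVneq A 0.
  exists 0; first by lra.
  by move=> t; rewrite normc0 !add0r addr0 !normcM normc_real ger0_norm ?normc_ge0.
have [->|B0] := eqVneq B 0.
  exists 0; first by lra.
  by move=> t; rewrite normc0 !mulr0 !addr0 normc_real ger0_norm ?normc_ge0.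
pose u := (A / (normc A)%:C).
pose v := (B / (normc B)%:C).
have nA : (normc A)%:C != 0 by rewrite -normE normr_eq0.
have nB : (normc B)%:C != 0 by rewrite -normE normr_eq0.
have u1 : normc u = 1.
  by rewrite normcM normcV normc_real ger0_norm ?normc_ge0// divff// normc_eq0.
have v1 : normc v = 1.
  by rewrite normcM normcV normc_real ger0_norm ?normc_ge0// divff// normc_eq0.
have u0 : u != 0 by rewrite -normc_eq0 u1 oner_eq0.
have v0 : v != 0 by rewrite -normc_eq0 v1 oner_eq0.
have uv1 : normc (u / v) = 1 by rewrite normcM normcV u1 v1 invr1 mulr1.
have [c c2 ec] := cexpi_surj uv1.
exists c => // t.
have -> : A + cexpi (t + c) * B =
    u * ((normc A)%:C + cexpi t * (normc B)%:C).
  have eA : A = u * (normc A)%:C by rewrite divfK.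
  have eB : B = v * (normc B)%:C by rewrite divfK.
  rewrite cexpiD ec [X in _ * _ * X]eB [X in X + _]eA mulrDr; congr (_ + _).
  by rewrite mulrA -(mulrA (cexpi t)) divfK// mulrAC mulrC -mulrA mulrCA.
by rewrite normcM u1 mul1r.
Qed.

End ComplexModulus.

Section ComplexMeasurable.
Context d (T : measurableType d) (K : realType).
Implicit Types (f g : T -> K[i]) (F : {poly K[i]}).

(** Measurability of a complex function is stated on real and imaginary parts,
    so that only the Borel structure of the real field is involved. *)
Definition cmeasurable f := measurable_fun [set: T] (fun x => complex.Re (f x)) /\
  measurable_fun [set: T] (fun x => complex.Im (f x)).

Lemma cmeasurable_cst c : cmeasurable (fun=> c).
Proof. by split; exact: measurable_cst. Qed.

Lemma cmeasurableD f g : cmeasurable f -> cmeasurable g -> cmeasurable (fun x => f x + g x).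
Proof.
move=> [f1 f2] [g1 g2]; split.
  rewrite (_ : (fun x => _) = (fun x => complex.Re (f x) + complex.Re (g x))); first exact: measurable_funD.
  by apply/funext => x; case: (f x) (g x) => a b [].
rewrite (_ : (fun x => _) = (fun x => complex.Im (f x) + complex.Im (g x))); first exact: measurable_funD.
by apply/funext => x; case: (f x) (g x) => a b [].
Qed.

Lemma cmeasurableM f g : cmeasurable f -> cmeasurable g -> cmeasurable (fun x => f x * g x).
Proof.
move=> [f1 f2] [g1 g2]; split.
  rewrite (_ : (fun x => _) = (fun x => complex.Re (f x) * complex.Re (g x) - complex.Im (f x) * complex.Im (g x))).
    by apply: measurable_funB; apply: measurable_funM.
  by apply/funext => x; case: (f x) (g x) => a b [].
rewrite (_ : (fun x => _) = (fun x => complex.Re (f x) * complex.Im (g x) + complex.Im (f x) * complex.Re (g x))).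
  by apply: measurable_funD; apply: measurable_funM.
by apply/funext => x; case: (f x) (g x) => a b [].
Qed.

Lemma cmeasurable_cexpi (h : T -> K) : measurable_fun [set: T] h ->
  cmeasurable (fun x => cexpi (h x)).
Proof.
move=> mh; split => /=.
  apply: (measurableT_comp (f := @cos K)) => //.
  exact: continuous_measurable_fun (@continuous_cos K).
apply: (measurableT_comp (f := @sin K)) => //.
exact: continuous_measurable_fun (@continuous_sin K).
Qed.

Lemma cmeasurable_horner f F : cmeasurable f -> cmeasurable (fun x => F.[f x]).
Proof.
move=> mf; elim/poly_ind: F => [|F c IH].
  by under eq_fun do rewrite horner0; exact: cmeasurable_cst.
under eq_fun do rewrite hornerMXaddC.
by apply: cmeasurableD; [apply: cmeasurableM|exact: cmeasurable_cst].
Qed.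

Lemma measurable_normc f : cmeasurable f -> measurable_fun [set: T] (fun x => normc (f x)).
Proof.
move=> [f1 f2].
rewrite (_ : (fun x => _) = (fun x => Num.sqrt (complex.Re (f x) ^+ 2 + complex.Im (f x) ^+ 2))).
  apply: (measurableT_comp (f := @Num.sqrt K)).
    exact: continuous_measurable_fun (@sqrt_continuous K).
  by apply: measurable_funD; apply: measurable_funX.
by apply/funext => x; case: (f x).
Qed.

Lemma measurable_lne (f : T -> K) : measurable_fun [set: T] f ->
  measurable_fun [set: T] (fun x => lne (f x)%:E).
Proof.
move=> mf /=; apply: measurable_fun_ifT => //.
  by apply: measurable_fun_ler.
by apply/measurable_EFinP; apply: measurableT_comp.
Qed.

End ComplexMeasurable.

(** * Integrals over a period *)

Section Integrals.
Variable K : realType.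
Notation leb := (@lebesgue_measure K).
Notation mK := (measurableTypeR K).
Implicit Types (g : K -> K).

Lemma tonelli_in (A B : set K) (f : mK * mK -> \bar K) :
  measurable (A : set mK) -> measurable (B : set mK) ->
  measurable_fun [set: mK * mK] f -> (forall x, (0 <= f x)%E) ->
  (\int[leb]_(x in A) \int[leb]_(y in B) f (x, y) =
   \int[leb]_(y in B) \int[leb]_(x in A) f (x, y))%E.
Proof.
move=> mA mB mf f0; pose g := f \_ (A `*` B).
have mAB : measurable (A `*` B : set (mK * mK)) by exact: measurableX.
have mg : measurable_fun [set: mK * mK] g.
  apply/(measurable_restrictT _ _).1 => //; exact: measurable_funS mf.
have g0 x : (0 <= g x)%E by apply: erestrict_ge0.
rewrite [LHS]integral_mkcond [RHS]integral_mkcond.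
transitivity (\int[leb]_x \int[leb]_y g (x, y))%E.
  apply: eq_integral => x _; rewrite patchE; case: ifPn => xA.
    rewrite integral_mkcond; apply: eq_integral => y _.
    rewrite /g !patchE; congr (if _ then _ else _).
    by rewrite in_setX xA.
  rewrite integral0_eq// => y _; rewrite /g patchE ifF//.
  by rewrite in_setX (negbTE xA).
rewrite fubini_tonelli//.
apply: eq_integral => y _; rewrite patchE; case: ifPn => yB.
  rewrite [RHS]integral_mkcond; apply: eq_integral => x _.
  rewrite /g !patchE; congr (if _ then _ else _).
  by rewrite in_setX yB andbT.
rewrite integral0_eq// => x _; rewrite /g patchE ifF//.
by rewrite in_setX (negbTE yB) andbF.
Qed.

Lemma measurable_integral_in (A : set K) (f : mK * mK -> \bar K) :
  measurable (A : set mK) ->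
  measurable_fun [set: mK * mK] f -> (forall x, (0 <= f x)%E) ->
  measurable_fun [set: mK] (fun y => \int[leb]_(x in A) f (x, y))%E.
Proof.
move=> mA mf f0; pose g := f \_ (A `*` setT).
have mAT : measurable (A `*` setT : set (mK * mK)) by exact: measurableX.
have mg : measurable_fun [set: mK * mK] g.
  apply/(measurable_restrictT _ _).1 => //; exact: measurable_funS mf.
have g0 x : (0 <= g x)%E by apply: erestrict_ge0.
rewrite (_ : (fun y => _) = (fun y => \int[leb]_x g (x, y))%E).
  exact: (@measurable_fun_fubini_tonelli_G _ _ mK mK K leb g mg g0).
apply/funext => y; rewrite integral_mkcond; apply: eq_integral => x _.
rewrite /g !patchE; congr (if _ then _ else _).
by rewrite in_setX in_setT andbT.
Qed.

Lemma measurable_integral_in_r (A : set K) (f : mK * mK -> \bar K) :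
  measurable (A : set mK) ->
  measurable_fun [set: mK * mK] f -> (forall x, (0 <= f x)%E) ->
  measurable_fun [set: mK] (fun x => \int[leb]_(y in A) f (x, y))%E.
Proof.
move=> mA mf f0.
have ms : measurable_fun [set: mK * mK] (f \o (fun y => (y.2, y.1))).
  exact: (measurableT_comp mf (@measurable_swap _ _ mK mK)).
exact: (measurable_integral_in mA ms (fun x => f0 (x.2, x.1))).
Qed.

Lemma continuous_integrable g (a b : K) : continuous g ->
  leb.-integrable `[a, b] (EFin \o g).
Proof.
move=> cg; apply: continuous_compact_integrable; first exact: segment_compact.
exact: continuous_subspaceT.
Qed.

Lemma Rintegral_affine g (k c a b : K) : 0 < k -> a <= b -> continuous g ->
  \int[leb]_(t in `[k * a + c, k * b + c]) g t =
  k * \int[leb]_(t in `[a, b]) g (k * t + c).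
Proof.
move=> k0 ab cg; pose F t := k * t + c.
have dF (x : K) : is_derive x (1 : K) F k.
  by rewrite /F; apply: is_derive_eq; rewrite addr0 -[RHS]mulr1.
have F' : derive1 F = (fun=> k).
  by apply/funext => x; rewrite derive1E; exact: derive_val.
have cF : continuous F.
  move=> x; apply: differentiable_continuous; apply/derivable1_diffP.
  exact: ex_derive.
rewrite -RintegralZl//; last first.
  by apply: continuous_integrable => x; apply: (continuous_comp (cF x)); exact: cg.
rewrite /Rintegral; congr fine.
rewrite (_ : k * a + c = F a)// (_ : k * b + c = F b)//.
rewrite integration_by_substitution_increasing//.
- by apply: eq_integral => x _; rewrite F' /= mulrC.
- by move=> x y _ _ xy; rewrite ltrD2r ltr_pM2l.
- by rewrite F' => x _; exact: cst_continuous.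
- by rewrite F'; exact: is_cvg_cst.
- by rewrite F'; exact: is_cvg_cst.
- split; first by move=> x _; exact: ex_derive.
  + exact/cvg_at_right_filter/cF.
  + exact/cvg_at_left_filter/cF.
- exact: continuous_subspaceT.
Qed.

Lemma Rintegral_cat g (a b c : K) : a <= b -> b <= c -> continuous g ->
  \int[leb]_(t in `[a, c]) g t =
  \int[leb]_(t in `[a, b]) g t + \int[leb]_(t in `[b, c]) g t.
Proof.
move=> ab bc cg; have := @Rintegral_itvB _ g (BLeft a) (BRight c) b.
move=> /(_ (continuous_integrable _ _ cg)).
rewrite !bnd_simp => /(_ ab bc) e.
have ib : leb.-integrable `]b, c] (EFin \o g).
  by apply: integrableS (continuous_integrable b c cg) => //; exact: subset_itv_oc_cc.
by rewrite -(Rintegral_itv_obnd_cbnd ib) -e addrC subrK.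
Qed.

Notation tau := (2 * pi : K)%R.

Lemma tau_gt0 : 0 < tau. Proof. by rewrite mulr_gt0// pi_gt0. Qed.

Lemma measurable_circ : measurable (`[0%R, tau]%classic : set mK).
Proof. exact: measurable_itv. Qed.

Lemma leb_circ : leb `[0%R, tau] = tau%:E.
Proof. by rewrite lebesgue_measure_itv/= lte_fin tau_gt0/= oppr0 addr0. Qed.

Lemma Rintegral_circ_cst (c : K) : \int[leb]_(t in `[0%R, tau]) c = c * tau.
Proof. by rewrite Rintegral_cst//= leb_circ. Qed.

Lemma EFin_Rintegral (a b : K) (h : K -> K) : continuous h ->
  (\int[leb]_(t in `[a, b]) (h t)%:E = (\int[leb]_(t in `[a, b]) h t)%R%:E)%E.
Proof.
move=> ch; rewrite /Rintegral fineK//; apply: integrable_fin_num; first exact: measurable_itv.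
exact: continuous_integrable.
Qed.

Lemma integrable_circ_cst (c : K) : leb.-integrable `[0%R, tau] (fun=> c%:E).
Proof.
have cc : continuous (fun _ : K => c) by exact: cst_continuous.
exact: (continuous_integrable 0 tau cc).
Qed.

Lemma Rintegral_shift_period g (c : K) : 0 <= c <= tau -> continuous g ->
  (forall t, g (t + tau) = g t) ->
  \int[leb]_(t in `[0%R, tau]) g (t + c) = \int[leb]_(t in `[0%R, tau]) g t.
Proof.
move=> /andP[c0 ct] cg pg.
have := @Rintegral_affine g 1 c 0 tau ltr01 (ltW tau_gt0) cg.
rewrite mulr0 add0r !mul1r; under [X in _ = X -> _]eq_Rintegral do rewrite mul1r.
move=> <-; rewrite (@Rintegral_cat g c tau)//; last by lra.
have := @Rintegral_affine g 1 tau 0 c ltr01 c0 cg.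
rewrite mulr0 add0r !mul1r; under [X in _ = X -> _]eq_Rintegral do rewrite mul1r pg.
by rewrite (addrC tau) => ->; rewrite [RHS](@Rintegral_cat g 0 c)// addrC.
Qed.

Lemma Rintegral_mul_period g n : (0 < n)%N -> continuous g ->
  (forall t, g (t + tau) = g t) ->
  \int[leb]_(t in `[0%R, tau]) g (n%:R * t) = \int[leb]_(t in `[0%R, tau]) g t.
Proof.
move=> n0 cg pg; have t0 := tau_gt0.
have pgn k t : g (t + k%:R * tau) = g t.
  elim: k => [|k IH]; first by rewrite mul0r addr0.
  by rewrite -natr1 mulrDl mul1r addrA pg.
have e k : \int[leb]_(t in `[0, k%:R * tau]) g t =
    k%:R * \int[leb]_(t in `[0%R, tau]) g t.
  elim: k => [|k IH]; first by rewrite !mul0r set_itv1 Rintegral_set1.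
  rewrite (@Rintegral_cat g 0 (k%:R * tau))//; last 2 first.
  - by rewrite mulr_ge0// ltW.
  - by rewrite ler_pM2r// ler_nat.
  have nk : (k.+1%:R : K) = k%:R + 1 by rewrite natr1.
  rewrite IH nk [in RHS]mulrDl mul1r; congr (_ + _).
  have := @Rintegral_affine g 1 (k%:R * tau) 0 tau ltr01 (ltW t0) cg.
  rewrite mulr0 add0r !mul1r.
  under [X in _ = X -> _]eq_Rintegral do rewrite mul1r pgn.
  by rewrite [(k%:R + 1) * _]mulrDl mul1r [tau + _]addrC.
have nR : (0 : K) < n%:R by rewrite ltr0n.
have := @Rintegral_affine g n%:R 0 0 tau nR (ltW t0) cg.
rewrite mulr0 !addr0 e => /(mulfI (lt0r_neq0 nR)) ->.
by apply: eq_Rintegral => x _; rewrite addr0.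
Qed.

End Integrals.

(** * Jensen's formula for the logarithmic mean *)

Section ComplexContinuous.
Variable K : realType.
Implicit Types (f g : K -> K[i]) (F : {poly K[i]}).

Definition ccontinuous f := continuous (fun x => complex.Re (f x)) /\
  continuous (fun x => complex.Im (f x)).

Lemma ccontinuous_cst c : ccontinuous (fun=> c).
Proof. by split; exact: cst_continuous. Qed.

Lemma ccontinuousD f g : ccontinuous f -> ccontinuous g -> ccontinuous (fun x => f x + g x).
Proof.
move=> [f1 f2] [g1 g2]; split=> x.
  rewrite (_ : (fun x => _) = (fun x => complex.Re (f x) + complex.Re (g x))).
    exact: (cvgD (f1 x) (g1 x)).
  by apply/funext => y; case: (f y) (g y) => a b [].
rewrite (_ : (fun x => _) = (fun x => complex.Im (f x) + complex.Im (g x))).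
  exact: (cvgD (f2 x) (g2 x)).
by apply/funext => y; case: (f y) (g y) => a b [].
Qed.

Lemma ccontinuousM f g : ccontinuous f -> ccontinuous g -> ccontinuous (fun x => f x * g x).
Proof.
move=> [f1 f2] [g1 g2]; split=> x.
  rewrite (_ : (fun x => _) = (fun x => complex.Re (f x) * complex.Re (g x)
     - complex.Im (f x) * complex.Im (g x))).
    exact: (cvgB (cvgM (f1 x) (g1 x)) (cvgM (f2 x) (g2 x))).
  by apply/funext => y; case: (f y) (g y) => a b [].
rewrite (_ : (fun x => _) = (fun x => complex.Re (f x) * complex.Im (g x)
     + complex.Im (f x) * complex.Re (g x))).
  exact: (cvgD (cvgM (f1 x) (g2 x)) (cvgM (f2 x) (g1 x))).
by apply/funext => y; case: (f y) (g y) => a b [].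
Qed.

Lemma ccontinuous_cexpi : ccontinuous (@cexpi K).
Proof. by split; [exact: continuous_cos|exact: continuous_sin]. Qed.

Lemma continuous_normc f : ccontinuous f -> continuous (fun x => normc (f x)).
Proof.
move=> [f1 f2] x.
pose h y := complex.Re (f y) ^+ 2 + complex.Im (f y) ^+ 2.
have ch : {for x, continuous h}.
  by apply: cvgD; rewrite expr2; apply: cvgM; [exact: f1|exact: f1|exact: f2|exact: f2].
rewrite (_ : (fun x => _) = Num.sqrt \o h).
  exact: (continuous_comp ch (@sqrt_continuous K (h x))).
by apply/funext => y; rewrite /h /=; case: (f y).
Qed.

Lemma ccontinuous_horner F : ccontinuous (fun t => F.[cexpi t]).
Proof.
elim/poly_ind: F => [|F c IH].
  by under eq_fun do rewrite horner0; exact: ccontinuous_cst.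
under eq_fun do rewrite hornerMXaddC.
by apply: ccontinuousD; [apply: ccontinuousM => //; exact: ccontinuous_cexpi|exact: ccontinuous_cst].
Qed.

Lemma continuous_circ_abs F : continuous (circ_abs F).
Proof. by apply: continuous_normc; exact: ccontinuous_horner. Qed.

Lemma circ_abs_ge0 F t : 0 <= circ_abs F t.
Proof. exact: normc_ge0. Qed.

Lemma circ_abs_bounded F : exists2 M : K, 0 < M & forall t, circ_abs F t <= M.
Proof.
elim/poly_ind: F => [|F c [M M0 IH]].
  by exists 1 => // t; rewrite /circ_abs horner0 normc0.
exists (M + normc c) => [|t]; first by rewrite ltr_wpDr ?normc_ge0.
rewrite /circ_abs hornerMXaddC (le_trans (normcD_le _ _))// lerD2r.
by rewrite normcM normc_cexpi mulr1 IH.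
Qed.

Lemma continuous_lnmax (u : K -> K) t : 0 < t -> continuous u ->
  continuous (fun s => ln (Num.max (u s) t)).
Proof.
move=> t0 cu s; have c : {for s, continuous (fun s => Num.max (u s) t)}.
  by apply: continuous_max; [exact: cu|exact: cst_continuous].
apply: (continuous_comp c); apply: continuous_ln.
by rewrite lt_max t0 orbT.
Qed.

End ComplexContinuous.

Section Jensen.
Variable K : realType.
Notation leb := (@lebesgue_measure K).
Notation tau := (2 * pi : K)%R.
Implicit Types (a w : K[i]) (t : K) (F : {poly K[i]}).
Hint Resolve measurable_circ : core.

Let normc_bounds a t :
  1 - normc a <= normc (1 - a * cexpi t) <= 1 + normc a.
Proof.
have na : normc (a * cexpi t) = normc a by rewrite normcM normc_cexpi mulr1.
apply/andP; split.
  rewrite lerBlDr; have := normcD_le (1 - a * cexpi t) (a * cexpi t).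
  by rewrite subrK normc1 na.
by have := normcD_le 1 (- (a * cexpi t)); rewrite normcN normc1 na.
Qed.

Let lf a t := ln (normc (1 - a * cexpi t)).
Let I a := \int[leb]_(t in `[0%R, tau]) lf a t.

Let lf_cont a : normc a < 1 -> continuous (lf a).
Proof.
move=> a1 t.
have c1 : continuous (fun t => normc (1 - a * cexpi t)).
  apply: continuous_normc; apply: ccontinuousD; first exact: ccontinuous_cst.
  rewrite (_ : (fun x => _) = (fun x => (- a) * cexpi x)).
    by apply: ccontinuousM; [exact: ccontinuous_cst|exact: ccontinuous_cexpi].
  by apply/funext => x; rewrite mulNr.
apply: (continuous_comp (c1 t)); apply: continuous_ln; have /andP[h _] := normc_bounds a t.
by apply: lt_le_trans h; rewrite subr_gt0.
Qed.

Let lf_period a t : lf a (t + tau) = lf a t.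
Proof. by rewrite /lf cexpiD2pi. Qed.

Let I_double a : normc a < 1 -> 2 * I a = I (a ^+ 2).
Proof.
move=> a1; have pi0 := @pi_gt0 K.
have a2 : normc (a ^+ 2) < 1 by rewrite normcX exprn_ilt1// normc_ge0.
have pos b t : normc b < 1 -> 0 < normc (1 - b * cexpi t).
  by move=> b1; have /andP[h _] := normc_bounds b t; apply: lt_le_trans h; rewrite subr_gt0.
have Na : normc (- a) < 1 by rewrite normcN.
have ec : cexpi (pi : K) = -1 by rewrite /cexpi cospi sinpi; apply/eqP; rewrite eq_complex /= oppr0 !eqxx.
(* replacing a by - a is the rotation by pi *)
have IN : I (- a) = I a.
  have pi2 : 0 <= (pi : K) <= tau by rewrite ltW//= mulr_natl mulr2n lerDl ltW.
  rewrite /I -(Rintegral_shift_period pi2 (lf_cont Na) (lf_period (- a))).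
  apply: eq_Rintegral => t _; rewrite /lf cexpiD ec; congr (ln (normc _)).
  by ring.
rewrite mulr_natl mulr2n -{2}IN /I -RintegralD//; last 2 first.
- exact: continuous_integrable (lf_cont _).
- exact: continuous_integrable (lf_cont _).
rewrite -(@Rintegral_mul_period _ (lf (a ^+ 2)) 2 isT (lf_cont a2) (lf_period _)).
apply: eq_Rintegral => t _; rewrite /lf -lnM ?posrE ?pos//; congr ln.
by rewrite -normcM cexpi_mulrn; congr normc; ring.
Qed.

Let I_bound a : normc a < 1 -> `|I a| <= - ln (1 - normc a) * tau.
Proof.
move=> a1; have i1 := continuous_integrable 0 tau (lf_cont a1).
apply: le_trans (le_normr_Rintegral _ i1) _ => //.
rewrite -Rintegral_circ_cst; apply: le_Rintegral => //.
- exact: integrable_norm.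
- exact: continuous_integrable (@cst_continuous _ _ _).
move=> t _; have /andP[h1 h2] := normc_bounds a t.
have p1 : 0 < 1 - normc a by rewrite subr_gt0.
have na := normc_ge0 a.
have p2 : 0 < 1 + normc a by lra.
have p3 : 0 < normc (1 - a * cexpi t) by apply: lt_le_trans h1.
rewrite /lf ler_norml opprK; apply/andP; split.
  by rewrite ler_ln ?posrE.
rewrite -lnV ?posrE// ler_ln ?posrE ?invr_gt0// (le_trans h2)//.
by rewrite -[leRHS]mul1r ler_pdivlMr//; nra.
Qed.

(** From |1 - a z| |1 + a z| = |1 - a^2 z^2| one gets 2 I(a) = I(a^2); iterating,
    2^k I(a) = I(a^(2^k)) stays bounded, so I(a) = 0. *)
Lemma log_mean_inside a : normc a < 1 -> I a = 0.
Proof.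
move=> a1; apply/eqP; rewrite -normr_le0 leNgt; apply/negP => I0.
pose c := - ln (1 - normc a) * tau.
have h k : 2 ^+ k * `|I a| <= c.
  have e : 2 ^+ k * I a = I (a ^+ (2 ^ k)%N).
    elim: k => [|k IH]; first by rewrite mul1r.
    rewrite exprS -mulrA IH I_double ?expnSr ?exprM//.
    by rewrite normcX exprn_ilt1 ?normc_ge0// -lt0n expn_gt0.
  have ak : normc (a ^+ (2 ^ k)%N) <= normc a.
    by rewrite normcX; apply: ler_iXnr; rewrite ?expn_gt0 ?normc_ge0 ?ltW.
  have -> : 2 ^+ k * `|I a| = `|I (a ^+ (2 ^ k)%N)|.
    by rewrite -e normrM [`|2 ^+ k|]ger0_norm.
  apply: le_trans (I_bound (le_lt_trans ak a1)) _.
  rewrite /c ler_pM2r ?tau_gt0// lerN2 ler_ln ?posrE ?subr_gt0//.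
    by rewrite lerB.
  exact: le_lt_trans a1.
pose m := Num.truncn (c / `|I a|).
have : c / `|I a| < m.+1%:R by exact: truncnS_gt.
rewrite ltr_pdivrMr// ltNge => /negP; apply; apply: le_trans (h m.+1).
by rewrite ler_pM2r// -natrX ler_nat ltnW// ltn_expl.
Qed.


Let xw w t := normc (cexpi t - w).

Let xw_cont w : continuous (xw w).
Proof.
apply: continuous_normc; apply: ccontinuousD; first exact: ccontinuous_cexpi.
exact: ccontinuous_cst.
Qed.

Lemma log_mean_outside w : 1 < normc w ->
  (forall t, 0 < xw w t) /\
  \int[leb]_(t in `[0%R, tau]) ln (xw w t) = ln (normc w) * tau.
Proof.
move=> w1; have w0 : w != 0 by rewrite -normc_gt0 (lt_trans _ w1).
have p : 0 < normc w by rewrite normc_gt0.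
have a1 : normc w^-1 < 1 by rewrite normcV invf_lt1.
have pos t : 0 < normc (1 - w^-1 * cexpi t).
  by have /andP[h _] := normc_bounds w^-1 t; apply: lt_le_trans h; rewrite subr_gt0.
have e t : xw w t = normc w * normc (1 - w^-1 * cexpi t).
  rewrite -normcM /xw -normcN; congr normc.
  by rewrite mulrBr mulr1 mulrA divff// mul1r opprB.
split; first by move=> t; rewrite e mulr_gt0.
under eq_Rintegral do rewrite e lnM ?posrE//.
rewrite RintegralD//; last 2 first.
- exact: continuous_integrable (@cst_continuous _ _ _).
- exact: continuous_integrable (lf_cont a1).
by have := log_mean_inside a1; rewrite /I /lf => ->; rewrite Rintegral_circ_cst addr0.
Qed.

Let lne_meas (f : K -> K) : continuous f ->
  measurable_fun `[0%R, tau] (fun t => lne (f t)%:E).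
Proof.
move=> cf; apply: measurable_funTS; apply: measurable_lne.
exact: continuous_measurable_fun.
Qed.

(* the regularisation *)
(** For |w| = 1 and s = 1 + 1/(k+1), e2 k is (s - 1)^2 / s: adding it to
    |e^{it} - w|^2 gives |e^{it} - s w|^2 / s, whose logarithmic mean is known
    since s w lies outside the disc. *)
Let e2 k : K := harmonic k ^+ 2 / (1 + harmonic k).

Let hk0 k : 0 < harmonic k :> K.
Proof. exact: harmonic_gt0. Qed.

Let e2_gt0 k : 0 < e2 k.
Proof. by rewrite divr_gt0 ?exprn_gt0// addr_gt0. Qed.

Let hk1 k : harmonic k <= 1 :> K.
Proof. by rewrite invf_le1// ler1n. Qed.

Let e2_le k : e2 k <= harmonic k.
Proof.
have := hk0 k; have := hk1 k => h1 h0.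
rewrite ler_pdivrMr ?addr_gt0//; nra.
Qed.

Let e2_le2 k : e2 k <= harmonic k ^+ 2.
Proof.
have h0 := hk0 k; rewrite ler_pdivrMr ?addr_gt0// mulrDr mulr1 lerDl.
by rewrite mulr_ge0 ?exprn_ge0 ?ltW.
Qed.

Let e2_anti k m : (k <= m)%N -> e2 m <= e2 k.
Proof.
move=> km; have a0 := hk0 k; have b0 := hk0 m.
have ba : harmonic m <= harmonic k :> K by rewrite lef_pV2 ?posrE// ler_nat.
rewrite /e2; move: (harmonic k : K) (harmonic m : K) a0 b0 ba => a b a0 b0 ba.
rewrite ler_pdivrMr ?addr_gt0// mulrAC ler_pdivlMr ?addr_gt0// -subr_ge0.
have -> : a ^+ 2 * (1 + b) - b ^+ 2 * (1 + a) = (a - b) * (a + b + a * b) by ring.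
by rewrite mulr_ge0 ?subr_ge0// !addr_ge0 ?mulr_ge0// ltW.
Qed.

Let e2_cvg : e2 @ \oo --> (0 : K).
Proof.
apply: (@squeeze_cvgr _ _ _ _ (cst 0) harmonic).
- by near=> k; rewrite ltW//= e2_le.
- exact: cvg_cst.
- exact: cvg_harmonic.
Unshelve. all: by end_near. Qed.

(* |e^{it}-sw|^2/s = (s-1)^2/s + |e^{it}-w|^2 *)
Let xw_reg w t k : normc w = 1 -> let s := 1 + harmonic k in
  xw (s%:C * w) t ^+ 2 = s * (xw w t ^+ 2 + e2 k).
Proof.
move=> w1 s; case: w w1 => a b; rewrite /normc => w1.
have ab : a ^+ 2 + b ^+ 2 = 1.
  by rewrite -(sqr_sqrtr (_ : 0 <= a ^+ 2 + b ^+ 2)) ?addr_ge0 ?sqr_ge0// w1 expr1n.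
have s0 : s != 0 by rewrite lt0r_neq0// addr_gt0.
have -> : e2 k = (s - 1) ^+ 2 / s by rewrite /e2 /s addrAC subrr add0r.
rewrite /xw /cexpi /= !sqr_sqrtr ?addr_ge0 ?sqr_ge0//.
have cs := cos2Dsin2 t.
rewrite mulrDr [s * (_ / s)]mulrC divfK//.
move: (cos t) (sin t) cs => c d cs.
rewrite !mul0r subr0 addr0.
have -> : (c - s * a) ^+ 2 + (d - s * b) ^+ 2 =
  (c ^+ 2 + d ^+ 2) - 2 * s * (c * a + d * b) + s ^+ 2 * (a ^+ 2 + b ^+ 2) by ring.
have -> : (c - a) ^+ 2 + (d - b) ^+ 2 =
  (c ^+ 2 + d ^+ 2) - 2 * (c * a + d * b) + (a ^+ 2 + b ^+ 2) by ring.
by rewrite cs ab; ring.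
Qed.

Let xw_le2 w t : normc w = 1 -> xw w t <= 2.
Proof.
by move=> w1; rewrite (le_trans (normcD_le _ _))// normcN w1 normc_cexpi.
Qed.

Let lnr w k t := 2^-1 * ln (xw w t ^+ 2 + e2 k).

Let lnr_pos w k t : 0 < xw w t ^+ 2 + e2 k.
Proof. by rewrite ltr_wpDl ?sqr_ge0. Qed.

Let lnr_cont w k : continuous (lnr w k).
Proof.
move=> t; apply: cvgM; first exact: cvg_cst.
have c : {for t, continuous (fun t => xw w t ^+ 2 + e2 k)}.
  by apply: cvgD; [rewrite expr2; apply: cvgM; exact: xw_cont|exact: cvg_cst].
by apply: (continuous_comp c); apply: continuous_ln.
Qed.

Let lnr_mean w k : normc w = 1 ->
  \int[leb]_(t in `[0%R, tau]) lnr w k t = 2^-1 * ln (1 + harmonic k) * tau.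
Proof.
move=> w1; set s := 1 + harmonic k.
have s1 : 1 < s by rewrite ltrDl.
have s0 : 0 < s by apply: lt_trans s1.
have sw : normc (s%:C * w) = s by rewrite normcM w1 mulr1 normc_real gtr0_norm.
have [pos e] := @log_mean_outside (s%:C * w) (ltac:(by rewrite sw)).
have el t : lnr w k t = ln (xw (s%:C * w) t) - 2^-1 * ln s.
  have := xw_reg t k w1; cbv zeta; rewrite -/s => /(congr1 (@ln K)).
  rewrite lnXn// lnM ?posrE// /lnr mulr2n => h; lra.
under eq_Rintegral do rewrite el.
rewrite RintegralB//; last 2 first.
- apply: continuous_integrable => t; apply: (continuous_comp (@xw_cont _ t)).
  exact: continuous_ln.
- exact: continuous_integrable (@cst_continuous _ _ _).
rewrite Rintegral_circ_cst e sw; lra.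
Qed.

Let lnr_cvg w t : (- lnr w k t)%:E @[k --> \oo] --> (- lne (xw w t)%:E)%E.
Proof.
have [x0|x0] := leP (xw w t) 0.
  have xe : xw w t = 0 by apply/eqP; rewrite eq_le x0 normc_ge0.
  rewrite xe /= lexx /=; apply/cvgeryP/cvgryPge => A.
  near=> k.
  rewrite /lnr xe expr0n add0r.
  apply: (@le_trans _ _ (- (2^-1 * ln (harmonic k ^+ 2)))); last first.
    by rewrite lerN2 ler_pM2l ?invr_gt0// ler_ln ?posrE// exprn_gt0.
  have hk : (harmonic k : K) = (k.+1%:R)^-1 by [].
  have -> : - (2^-1 * ln (harmonic k ^+ 2)) = ln (k.+1%:R : K).
    have eX := lnXn 2 (hk0 k); rewrite mulr2n in eX.
    have eV : ln (harmonic k : K) = - ln k.+1%:R by rewrite hk lnV ?posrE.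
    lra.
  rewrite -(expRK A) ler_ln ?posrE ?expR_gt0//.
  near: k; exists (Num.truncn (expR A)) => //= k hkA.
  apply/ltW/(lt_le_trans (truncnS_gt _)); by rewrite ler_nat.
rewrite /= leNgt x0 /=; apply/cvg_EFin; first by near=> k.
rewrite /=; apply: cvgN.
have -> : ln (xw w t) = 2^-1 * ln (xw w t ^+ 2).
  by have eX := lnXn 2 x0; rewrite mulr2n in eX; lra.
apply: cvgM; first exact: cvg_cst.
have c : (fun k => xw w t ^+ 2 + e2 k) k @[k --> \oo] --> xw w t ^+ 2.
  by rewrite -[X in _ --> X]addr0; apply: cvgD => //; exact: cvg_cst.
have cl : {for xw w t ^+ 2, continuous (@ln K)}.
  by apply: continuous_ln; rewrite exprn_gt0.
exact: (cvg_comp _ _ c cl).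
Unshelve. all: by end_near. Qed.

(** A zero on the circle makes the logarithm unbounded below; its mean is reached
    from points outside the disc by monotone convergence. *)
Lemma log_mean_circle w : normc w = 1 ->
  leb.-integrable `[0%R, tau] (fun t => lne (xw w t)%:E) /\
  (\int[leb]_(t in `[0%R, tau]) lne (xw w t)%:E = 0)%E.
Proof.
(* 5 bounds the logarithms, so that g k is non-negative and increases with k *)
move=> w1; pose g k t := (5 - lnr w k t)%:E.
have lnr_le k t : lnr w k t <= 5.
  rewrite /lnr; have := ln_sublinear (lnr_pos w k t).
  have := xw_le2 t w1; have := normc_ge0 (cexpi t - w); rewrite -/(xw w t).
  by have := e2_le k; have := hk1 k; nra.
have mg k : measurable_fun `[0%R, tau] (g k).
  have cg : continuous (fun t => 5 - lnr w k t).
    by move=> t; apply: cvgB; [exact: cvg_cst|exact: lnr_cont].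
  by apply/measurable_EFinP/measurable_funTS; exact: continuous_measurable_fun cg.
have g0 k t : (0 <= g k t)%E by rewrite lee_fin subr_ge0.
have gnd t : nondecreasing_seq (g ^~ t).
  move=> k m km; rewrite lee_fin lerB// ler_pM2l ?invr_gt0//.
  by rewrite ler_ln ?posrE// lerD2l e2_anti.
have gcvg t : g k t @[k --> \oo] --> (5%:E - lne (xw w t)%:E)%E.
  rewrite (_ : g ^~ t = fun k => (5%:E + (- lnr w k t)%:E)%E); last by [].
  apply: cvgeD; [|exact: cvg_cst|exact: lnr_cvg].
  by rewrite fin_num_adde_defr.
have eg k : (\int[leb]_(t in `[0%R, tau]) g k t =
    (5 * tau - 2^-1 * ln (1 + harmonic k) * tau)%:E)%E.
  have ig : leb.-integrable `[0%R, tau] (EFin \o (fun t => 5 - lnr w k t)).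
    apply: continuous_integrable => t; apply: cvgB; first exact: cvg_cst.
    exact: lnr_cont.
  have e : \int[leb]_(t in `[0%R, tau]) (5 - lnr w k t) =
      5 * tau - 2^-1 * ln (1 + harmonic k) * tau.
    rewrite RintegralB//; last 2 first.
    - exact: continuous_integrable (@cst_continuous _ _ _).
    - exact: continuous_integrable (@lnr_cont w k).
    by rewrite Rintegral_circ_cst lnr_mean.
  by rewrite -e /Rintegral fineK//; exact: integrable_fin_num.
have lim2 : (5 * tau - 2^-1 * ln (1 + harmonic k) * tau)%:E @[k --> \oo] -->
    (5 * tau)%:E.
  apply/cvg_EFin; first by near=> k.
  rewrite /= -[X in _ --> X]subr0; apply: cvgB; first exact: cvg_cst.
  rewrite -[X in _ --> X](mul0r tau); apply: cvgM; last exact: cvg_cst.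
  rewrite -[X in _ --> X](mulr0 2^-1); apply: cvgM; first exact: cvg_cst.
  have c : (fun k => 1 + harmonic k : K) k @[k --> \oo] --> (1 : K).
    rewrite -[X in _ --> X]addr0; apply: cvgD; first exact: cvg_cst.
    exact: cvg_harmonic.
  have cl : {for 1, continuous (@ln K)} by exact: continuous_ln.
  by rewrite -(@ln1 K); exact: (cvg_comp _ _ c cl).
have mct := @cvg_monotone_convergence _ _ _ leb _ (@measurable_circ K) g mg (fun k t _ => g0 k t)
   (fun t _ => gnd t).
have e5 : (\int[leb]_(t in `[0%R, tau]) (5%:E - lne (xw w t)%:E) = (5 * tau)%:E)%E.
  transitivity (\int[leb]_(t in `[0%R, tau]) limn (g ^~ t))%E.
    by apply: eq_integral => t _; apply/esym/cvg_lim => //; exact: gcvg.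
  rewrite (_ : (fun k => _) = fun k =>
      (5 * tau - 2^-1 * ln (1 + harmonic k) * tau)%:E) in mct; last first.
    by apply/funext => k; exact: eg.
  by rewrite -(cvg_lim _ mct)//; apply/cvg_lim => //; exact: lim2.
have lm := lne_meas (@xw_cont w).
have pos5 t : (0 <= 5%:E - lne (xw w t)%:E)%E.
  rewrite -(cvg_lim (@ereal_hausdorff K) (gcvg t)); apply: lime_ge.
    by apply/cvg_ex; eexists; exact: gcvg.
  by near=> k.
have i5 : leb.-integrable `[0%R, tau] (fun t => 5%:E - lne (xw w t)%:E)%E.
  apply/integrableP; split; first exact: emeasurable_funB.
  by under eq_integral do rewrite gee0_abs//; rewrite e5 ltry.
have ic := integrable_circ_cst (5 : K).
have el t : lne (xw w t)%:E = (5%:E - (5%:E - lne (xw w t)%:E))%E.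
  by case: (lne _) => [r| |]//=; rewrite -!EFinB; congr EFin; lra.
have ie : (fun t => lne (xw w t)%:E) = (fun t => 5%:E - (5%:E - lne (xw w t)%:E))%E.
  by apply/funext => t; exact: el.
split.
  by rewrite ie; exact: integrableB.
rewrite ie (integralB (@measurable_circ K) ic i5) e5 integral_cst//= leb_circ -EFinM -EFinB.
by rewrite subrr.
Unshelve. all: by end_near. Qed.

End Jensen.

Section JensenPoly.
Variable K : realType.
Notation leb := (@lebesgue_measure K).
Notation tau := (2 * pi : K)%R.
Notation mK := (measurableTypeR K).
Implicit Types (a w : K[i]) (t : K) (F G P : {poly K[i]}).
Hint Resolve measurable_circ : core.

Lemma lneM_ge0 (x y : K) : 0 <= x -> 0 <= y ->
  lne (x * y)%:E = (lne x%:E + lne y%:E)%E.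
Proof.
rewrite le_eqVlt => /predU1P[<- _|x0]; first by rewrite mul0r /= lexx addNye//; case: ifP.
rewrite le_eqVlt => /predU1P[<-|y0]; first by rewrite mulr0 /= lexx addeNy//; case: ifP.
by rewrite !lne_EFin ?mulr_gt0// lnM ?posrE.
Qed.

Lemma log_mean w : 1 <= normc w ->
  leb.-integrable `[0%R, tau] (fun t => lne (normc (cexpi t - w))%:E) /\
  (\int[leb]_(t in `[0%R, tau]) lne (normc (cexpi t - w))%:E =
   (ln (normc w) * tau)%:E)%E.
Proof.
rewrite le_eqVlt => /predU1P[w1|w1].
  by have [h1 h2] := log_mean_circle (esym w1); rewrite -w1 ln1 mul0r.
have [pos e] := log_mean_outside w1.
have el t : lne (normc (cexpi t - w))%:E = (ln (normc (cexpi t - w)))%:E.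
  by rewrite lne_EFin.
have cl : continuous (fun t => ln (normc (cexpi t - w))).
  move=> t; have c : continuous (fun t => normc (cexpi t - w)).
    by apply: continuous_normc; apply: ccontinuousD; [exact: ccontinuous_cexpi|exact: ccontinuous_cst].
  by apply: (continuous_comp (c t)); exact: continuous_ln.
under [X in integrable _ _ X]eq_fun do rewrite el.
under eq_integral do rewrite el.
split; first exact: continuous_integrable.
by rewrite EFin_Rintegral// e.
Qed.

(** Jensen's formula; zeros on the circle are allowed. *)
Lemma jensen n F : (size F <= n.+1)%N -> zero_free_open F ->
  leb.-integrable `[0%R, tau] (fun t => lne (circ_abs F t)%:E) /\
  (\int[leb]_(t in `[0%R, tau]) lne (circ_abs F t)%:E =
   (ln (normc F.[0]) * tau)%:E)%E.
Proof.
have cst_case c : zero_free_open c%:P ->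
    leb.-integrable `[0%R, tau] (fun t => lne (circ_abs c%:P t)%:E) /\
    (\int[leb]_(t in `[0%R, tau]) lne (circ_abs c%:P t)%:E =
     (ln (normc c%:P.[0]) * tau)%:E)%E.
  move=> hc; have c0 : c != 0 by have := hc 0; rewrite hornerC normr0 ltr01; apply.
  have el t : lne (circ_abs c%:P t)%:E = (ln (normc c))%:E.
    by rewrite /circ_abs hornerC lne_EFin// normc_gt0.
  have cc : continuous (fun _ : K => ln (normc c)) by exact: cst_continuous.
  under [X in integrable _ _ X]eq_fun do rewrite el.
  under eq_integral do rewrite el.
  split; first exact: (continuous_integrable 0 tau cc).
  by rewrite (EFin_Rintegral _ _ cc) Rintegral_circ_cst hornerC.
elim: n F => [|n IH] F sF hF; have [[c eF]|] := poly_const_or_root sF.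
- by rewrite eF; apply: cst_case; rewrite -eF.
- by case=> m [w [G []]].
- by rewrite eF; apply: cst_case; rewrite -eF.
move=> [m [w [G [/eqP + sG eF]]]].
rewrite eqSS => /eqP nm; rewrite -{m}nm in sG.
move: hF; rewrite eF => /zero_free_open_factor[hG w1].
have w1' : 1 <= normc w by rewrite -lecR -normE.
have [iG eG] := IH _ sG hG.
have [iw ew] := log_mean w1'.
have el t : lne (circ_abs (G * ('X - w%:P)) t)%:E =
    (lne (circ_abs G t)%:E + lne (normc (cexpi t - w))%:E)%E.
  by rewrite /circ_abs hornerM hornerXsubC normcM lneM_ge0 ?normc_ge0.
under [X in integrable _ _ X]eq_fun do rewrite el.
under eq_integral do rewrite el.
split; first exact: integrableD.
have G0 : 0 < normc G.[0] by rewrite normc_gt0 hG// normr0 ltr01.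
rewrite integralD// eG ew -EFinD hornerM hornerXsubC sub0r normcM normcN.
by rewrite lnM ?posrE// ?mulrDl// (lt_le_trans ltr01).
Qed.

(** On the circle the two coefficients of a polynomial of degree one can be
    exchanged, so its zero can be assumed to lie outside the disc. *)
Lemma normc_cexpi_swap (x y : K[i]) t :
  normc (x + y * cexpi t) = normc (y^*%C + x^*%C * cexpi t).
Proof.
have ec : cexpi t * (cexpi t)^*%C = 1.
  by rewrite -cexpiN -cexpiD subrr cexpi0.
rewrite -[RHS]normc_conj rmorphD rmorphM /= !conjcK.
rewrite -[LHS]mul1r -(normc_cexpi (- t)) -normcM cexpiN; congr normc.
by rewrite mulrDr mulrC addrC; congr (_ + _); rewrite mulrCA [_^*%C * _]mulrC ec mulr1.
Qed.

Lemma log_mean_translate w t : 0 < t ->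
  leb.-integrable `[0%R, tau] (fun g => lne (normc (w + t%:C * cexpi g))%:E) /\
  (\int[leb]_(g in `[0%R, tau]) lne (normc (w + t%:C * cexpi g))%:E =
   (ln (Num.max (normc w) t) * tau)%:E)%E.
Proof.
move=> t0.
have key (x y : K[i]) : normc y <= normc x -> x != 0 ->
   leb.-integrable `[0%R, tau] (fun g => lne (normc (x + y * cexpi g))%:E) /\
   (\int[leb]_(g in `[0%R, tau]) lne (normc (x + y * cexpi g))%:E =
    (ln (normc x) * tau)%:E)%E.
  move=> yx x0; have sF : (size (y *: 'X + x%:P : {poly K[i]})%R <= 2)%N.
    rewrite (leq_trans (size_polyD _ _))// geq_max.
    rewrite (leq_trans (size_scale_leq _ _)) ?size_polyX//.
    by rewrite (leq_trans (size_polyC_leq1 _)).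
  have hF : zero_free_open (y *: 'X + x%:P).
    move=> z; rewrite -[1]normr1 lt_normc normc1 => z1.
    rewrite hornerD hornerZ hornerX hornerC addr_eq0.
    apply/eqP => /(congr1 (@normc K)); rewrite normcM normcN => e.
    have := normc_gt0 x; rewrite x0 => xp.
    have : normc y * normc z < normc x.
      have [y0|y0] := eqVneq y 0; first by rewrite y0 normc0 mul0r.
      have yp : 0 < normc y by rewrite normc_gt0.
      by apply: lt_le_trans yx; rewrite gtr_pMr.
    by rewrite e ltxx.
  have := jensen sF hF; rewrite hornerD hornerZ hornerX hornerC mulr0 add0r.
  rewrite (_ : (fun s => lne (circ_abs _ s)%:E) =
    (fun s => lne (normc (x + y * cexpi s))%:E))//.
  by apply/funext => s; rewrite /circ_abs hornerD hornerZ hornerX hornerC addrC.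
have [tw|wt] := leP t (normc w).
  apply: key; first by rewrite normc_real gtr0_norm.
  by rewrite -normc_gt0 (lt_le_trans t0).
have := @key (t%:C)^*%C w^*%C; rewrite !normc_conj normc_real gtr0_norm// ltW//.
rewrite (_ : (fun s => lne (normc (t%:C^*%C + _))%:E) =
    (fun s => lne (normc (w + t%:C * cexpi s))%:E)).
  by apply=> //; rewrite conjc_eq0 -normc_gt0 normc_real gtr0_norm.
by apply/funext => s; rewrite [in RHS]normc_cexpi_swap.
Qed.

End JensenPoly.

(** * Multipliers do not increase means of log max *)

Section Arestov.
Variable K : realType.
Notation leb := (@lebesgue_measure K).
Notation tau := (2 * pi : K)%R.
Notation mK := (measurableTypeR K).
Implicit Types (a w : K[i]) (t : K) (F G P : {poly K[i]}).
Hint Resolve measurable_circ : core.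

Lemma circ_abs_eq F G : (forall z : K[i], `|z| = 1 -> `|F.[z]| = `|G.[z]|) ->
  circ_abs F = circ_abs G.
Proof.
move=> h; apply/funext => t; have := h (cexpi t) (norm_cexpi t).
by rewrite !normE => /complexI.
Qed.

Lemma circ_abs_le F G : (forall z : K[i], `|z| <= 1 -> `|F.[z]| <= `|G.[z]|) ->
  forall t, circ_abs F t <= circ_abs G t.
Proof. by move=> h t; rewrite -le_normc; apply: h; rewrite norm_cexpi. Qed.

Lemma log_integrable n F : (size F <= n.+1)%N -> F != 0 ->
  leb.-integrable `[0%R, tau] (fun t => lne (circ_abs F t)%:E).
Proof.
move=> sF F0; have [G [sG hG _ eq]] := outer_part sF F0.
by rewrite (circ_abs_eq eq); have [] := jensen sG hG.
Qed.

Lemma le_lne (x y : K) : 0 <= x -> x <= y -> (lne x%:E <= lne y%:E)%E.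
Proof.
move=> x0 xy; rewrite lee_lne// ?in_itv/= ?lee_fin ?x0 ?leey//.
by rewrite (le_trans x0).
Qed.

Lemma jensen_sub n F (k : K) : (size F <= n.+1)%N -> zero_free_open F ->
  (\int[leb]_(t in `[0%R, tau]) (k%:E - lne (circ_abs F t)%:E) =
   \int[leb]_(t in `[0%R, tau]) k%:E - (ln (normc F.[0]) * tau)%:E)%E.
Proof.
move=> sF hF; have [iF mF] := jensen sF hF.
by rewrite (integralB _ (integrable_circ_cst k) iF)// mF.
Qed.

Lemma log_mean_sub_le n F G (k : K) : (size F <= n.+1)%N ->
  leb.-integrable `[0%R, tau] (fun t => lne (circ_abs G t)%:E) ->
  (forall t, circ_abs F t <= circ_abs G t) ->
  (\int[leb]_(t in `[0%R, tau]) (k%:E - lne (circ_abs G t)%:E) <=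
   \int[leb]_(t in `[0%R, tau]) (k%:E - lne (circ_abs F t)%:E))%E.
Proof.
move=> sF iG le; have ik := integrable_circ_cst k.
have [F0|F0] := eqVneq F 0.
  have -> : (\int[leb]_(t in `[0%R, tau])
     (k%:E - lne (circ_abs F t)%:E) = +oo)%E.
    rewrite (_ : (fun t => _) = cst +oo%E).
      rewrite integral_cst//= leb_circ mulyr gtr0_sg ?tau_gt0//.
      by rewrite mul1e.
    by apply/funext => t; rewrite F0 /circ_abs horner0 normc0 /= lexx.
  exact: leey.
have iF := log_integrable sF F0.
apply: le_integral => //; [exact: integrableB|exact: integrableB|].
move=> t _; apply: leeB => //; apply: le_lne => //; exact: circ_abs_ge0.
Qed.

(** The case p = 0 of Arestov's inequality.  The means of F and of its outer part
    G agree, and so do those of G and of its image, both being log |G(0)|; the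
    image of F is dominated by that of G.  The mean is subtracted from k so that
    later uses only involve non-negative integrands. *)
Lemma log_mean_mulop (n : nat) (e : nat -> K[i]) F (k : K) :
  zero_free_open (symbol n e) -> e 0%N = 1 -> (size F <= n.+1)%N ->
  (\int[leb]_(t in `[0%R, tau]) (k%:E - lne (circ_abs F t)%:E) <=
   \int[leb]_(t in `[0%R, tau]) (k%:E - lne (circ_abs (mulop n e F) t)%:E))%E.
Proof.
move=> he e0 sF; have [->|F0] := eqVneq F 0.
  rewrite (_ : mulop n e 0 = 0)//; apply/polyP => j.
  by rewrite coef_poly !coef0 mulr0; case: ifP.
have [G [sG hG leG eqG]] := outer_part sF F0.
have hTG := mulop_zero_free_open he sG hG.
have [iTG _] := jensen (size_mulop n e G) hTG.
rewrite (circ_abs_eq eqG) (jensen_sub k sG hG).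
have : normc (mulop n e G).[0] = normc G.[0] by rewrite horner_mulop0 e0 mul1r.
move=> <-; rewrite -(jensen_sub k (size_mulop n e G) hTG).
apply: (log_mean_sub_le k (size_mulop n e F) iTG) => t.
by apply: circ_abs_le; apply: mulop_le => // z /ltW; apply: leG.
Qed.

Let lmax P t s := ln (Num.max (circ_abs P s) t).

(** The mean over g of log |w + t e^{ig}| is log max(|w|, t).  The bound on k
    makes the integrand non-negative, as Tonelli's theorem requires; the
    measurability and the sign of the inner integral serve for comparisons. *)
Lemma tonelli_logmax P t k : 0 < t -> (forall s, circ_abs P s + t <= expR k) ->
  (\int[leb]_(g in `[0%R, tau]) \int[leb]_(s in `[0%R, tau])
     (k%:E - lne (circ_abs (P + (t%:C * cexpi g)%:P) s)%:E) =
   ((k * tau - \int[leb]_(s in `[0%R, tau]) lmax P t s) * tau)%R%:E)%E /\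
  measurable_fun [set: mK] (fun g => \int[leb]_(s in `[0%R, tau])
     (k%:E - lne (circ_abs (P + (t%:C * cexpi g)%:P) s)%:E))%E /\
  (forall g, 0 <= \int[leb]_(s in `[0%R, tau])
     (k%:E - lne (circ_abs (P + (t%:C * cexpi g)%:P) s)%:E))%E.
Proof.
move=> t0 hk.
pose f (x : mK * mK) : \bar K :=
  (k%:E - lne (normc (P.[cexpi x.1] + t%:C * cexpi x.2))%:E)%E.
have fE s g : (k%:E - lne (circ_abs (P + (t%:C * cexpi g)%:P) s)%:E)%E = f (s, g).
  by rewrite /circ_abs hornerD hornerC.
have f0 x : (0 <= f x)%E.
  have h : (lne (normc (P.[cexpi x.1] + t%:C * cexpi x.2))%:E <= k%:E)%E.
    rewrite -[leRHS](expeRK k%:E); apply: le_lne; first exact: normc_ge0.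
    apply: le_trans (hk x.1); apply: le_trans (normcD_le _ _) _.
    by rewrite lerD2l normcM normc_cexpi mulr1 normc_real gtr0_norm.
  by rewrite /f sube_ge0 ?orbT.
have mf : measurable_fun [set: mK * mK] f.
  apply: emeasurable_funB => //; apply: measurable_lne; apply: measurable_normc.
  apply: cmeasurableD; first by apply: cmeasurable_horner; exact: cmeasurable_cexpi.
  by apply: cmeasurableM; [exact: cmeasurable_cst|exact: cmeasurable_cexpi].
have eF g : (\int[leb]_(s in `[0%R, tau])
     (k%:E - lne (circ_abs (P + (t%:C * cexpi g)%:P) s)%:E) =
   \int[leb]_(s in `[0%R, tau]) f (s, g))%E.
  by apply: eq_integral => s _; rewrite fE.
split; last first.
  split; last by move=> g; rewrite eF; exact: integral_ge0.
  rewrite (_ : (fun g => _) = (fun g => \int[leb]_(s in `[0%R, tau]) f (s, g))%E).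
    exact: measurable_integral_in.
  by apply/funext => g; exact: eF.
under eq_integral do rewrite eF.
rewrite -tonelli_in//.
have ik := integrable_circ_cst k.
have ef s : (\int[leb]_(g in `[0%R, tau]) f (s, g) = ((k - lmax P t s) * tau)%:E)%E.
  have [i m] := log_mean_translate P.[cexpi s] t0.
  rewrite /f /= (integralB _ ik i)// m integral_cst//= leb_circ -EFinM -EFinB.
  by rewrite mulrBl.
under eq_integral do rewrite ef.
have cl : continuous (lmax P t).
  by apply: continuous_lnmax => //; exact: continuous_circ_abs.
have ck : continuous (fun s => k - lmax P t s).
  by move=> s; apply: cvgB; [exact: cvg_cst|exact: cl].
rewrite (@EFin_Rintegral _ _ _ (fun s => (k - lmax P t s) * tau)); last first.
  by move=> s; apply: cvgM; [exact: ck|exact: cvg_cst].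
rewrite RintegralZr//; last exact: continuous_integrable.
rewrite RintegralB//; last exact: continuous_integrable.
by rewrite Rintegral_circ_cst.
Qed.

Lemma mulop_add_cst n (e : nat -> K[i]) P (c : K[i]) : e 0%N = 1 ->
  mulop n e (P + c%:P) = mulop n e P + c%:P.
Proof. by move=> e0; rewrite mulopD mulopC e0 mul1r. Qed.

(** Since e 0 = 1, adding a constant commutes with the multiplier; so the case
    p = 0 can be applied to every P + t e^{ig} and averaged over g. *)
Lemma logmax_mean_mulop n (e : nat -> K[i]) P t : zero_free_open (symbol n e) ->
  e 0%N = 1 -> (size P <= n.+1)%N -> 0 < t ->
  \int[leb]_(s in `[0%R, tau]) ln (Num.max (circ_abs (mulop n e P) s) t) <=
  \int[leb]_(s in `[0%R, tau]) ln (Num.max (circ_abs P s) t).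
Proof.
move=> he e0 sP t0.
have [M1 M10 hM1] := circ_abs_bounded P.
have [M2 M20 hM2] := circ_abs_bounded (mulop n e P).
pose k := ln (M1 + M2 + t).
have ek : expR k = M1 + M2 + t by rewrite lnK// posrE !addr_gt0.
have h1 s : circ_abs P s + t <= expR k.
  by rewrite ek lerD2r (le_trans (hM1 s))// lerDl ltW.
have h2 s : circ_abs (mulop n e P) s + t <= expR k.
  by rewrite ek lerD2r (le_trans (hM2 s))// lerDr ltW.
have [e1 [m1 p1]] := tonelli_logmax t0 h1.
have [e2 [m2 p2]] := tonelli_logmax t0 h2.
have : (((k * tau - \int[leb]_(s in `[0%R, tau]) lmax P t s) * tau)%R%:E <=
   ((k * tau - \int[leb]_(s in `[0%R, tau]) lmax (mulop n e P) t s) * tau)%R%:E)%E.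
  rewrite -e1 -e2; apply: ge0_le_integral.
  - exact: measurable_itv.
  - by move=> g _; exact: p1.
  - exact: measurable_funTS m1.
  - exact: measurable_funTS m2.
  move=> g _; rewrite -mulop_add_cst//; apply: log_mean_mulop => //.
  rewrite (leq_trans (size_polyD _ _))// geq_max sP.
  by rewrite (leq_trans (size_polyC_leq1 _)).
by rewrite lee_fin ler_pM2r ?tau_gt0// lerD2l lerN2.
Qed.

End Arestov.

(** * From means of log max to power means *)

Section PowerMeans.
Variable K : realType.
Notation leb := (@lebesgue_measure K).
Notation tau := (2 * pi : K)%R.
Notation mK := (measurableTypeR K).
Implicit Types (a w : K[i]) (t p : K) (F G P : {poly K[i]}).
Hint Resolve measurable_circ : core.

Lemma continuous_powR_comp (h : K -> K) p : 0 < p -> (forall t, 0 <= h t) ->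
  continuous h -> continuous (fun t => h t `^ p).
Proof.
move=> p0 h0 ch s; have := h0 s; rewrite le_eqVlt => /predU1P[hs|hs]; last first.
  have c : {for h s, continuous (fun x : K => x `^ p)}.
    apply: differentiable_continuous; apply/derivable1_diffP.
    by apply: derivable_powR; rewrite in_itv/= hs.
  exact: (continuous_comp (ch s) c).
rewrite /continuous_at -hs powR0 ?gt_eqF//; apply/cvgrPdist_lt => e e0.
have e1 : 0 < e `^ p^-1 by rewrite powR_gt0.
have := ch s; rewrite /continuous_at -hs => /cvgrPdist_lt/(_ _ e1) nh.
near=> t.
rewrite sub0r normrN ger0_norm ?powR_ge0//.
have : `|0 - h t| < e `^ p^-1 by near: t.
rewrite sub0r normrN ger0_norm// => ht.
have ee : e = (e `^ p^-1) `^ p by rewrite -powRrM mulVf ?gt_eqF// powRr1// ltW.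
by rewrite ee gt0_ltr_powR// nnegrE// ltW.
Unshelve. all: by end_near. Qed.

(** With x = log u and s = log t this expresses u^p, up to an affine function of
    log u, as a positive superposition of the functions log max(u, t). *)
Lemma integral_exp_hinge p (a b x : K) : a <= x -> x <= b ->
  (\int[leb]_(s in `[a, b]) (p ^+ 2 * expR (p * s) * (Num.max x s - s))%:E =
   (expR (p * x) - expR (p * a) * (p * (x - a) + 1))%:E)%E.
Proof.
move=> ax xb; pose f s := p ^+ 2 * expR (p * s) * (x - s).
pose F s := expR (p * s) * (p * (x - s) + 1).
have dF (s : K) : is_derive s (1 : K) F (f s).
  rewrite /F /f; apply: is_derive_eq; rewrite /GRing.scale/=; ring.
have cf : continuous f.
  move=> s; apply: differentiable_continuous; apply/derivable1_diffP.
  by rewrite /f; apply: ex_derive.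
transitivity (\int[leb]_(s in `[a, x]) (f s)%:E)%E.
  have -> : (`[a, x] = `[a, b] `&` `[a, x])%classic.
    by apply/esym/setIidr; apply: subset_itvl; rewrite bnd_simp.
  rewrite [RHS]integral_mkcondr; apply: eq_integral => s.
  rewrite inE/= in_itv/= => /andP[as_ sb]; rewrite patchE.
  case: ifPn; rewrite ?(inE, notin_setE)/= in_itv/= as_/= => sx.
    by rewrite /f max_l.
  move/negP: sx; rewrite -ltNge => sx.
  by rewrite max_r ?subrr ?mulr0// ltW.
have := ax; rewrite le_eqVlt => /predU1P[<-|{}ax].
  by rewrite set_itv1 integral_set1; congr EFin; rewrite subrr mulr0 add0r mulr1 subrr.
rewrite (@continuous_FTC2 _ f F)//.
- by rewrite -EFinB; congr EFin; rewrite /F subrr mulr0 add0r mulr1.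
- exact: continuous_subspaceT.
- have cF : continuous F.
    move=> s; apply: differentiable_continuous; apply/derivable1_diffP.
    exact: ex_derive.
  split; first by move=> s _; exact: ex_derive.
  + exact/cvg_at_right_filter/cF.
  + exact/cvg_at_left_filter/cF.
- by move=> s _; rewrite derive1E; exact: derive_val.
Qed.


Lemma max_lnmax (x e t : K) : 0 < e -> ln e <= t ->
  Num.max (ln (Num.max x e)) t = ln (Num.max x (expR t)).
Proof.
move=> e0 et; have {}et : e <= expR t.
  by rewrite -(lnK (x := e)) ?posrE// ler_expR.
have m0 : 0 < Num.max x e by rewrite lt_max e0 orbT.
have -> : Num.max x (expR t) = Num.max (Num.max x e) (expR t).
  by rewrite -maxA (max_r et).
have [h|h] := leP (Num.max x e) (expR t).
  by rewrite expRK max_r// -[leRHS]expRK ler_ln// posrE expR_gt0.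
by rewrite max_l// -[leLHS]expRK ler_ln ?posrE ?expR_gt0// ltW.
Qed.

(** The previous identity integrated over the circle; g t is the inner integral,
    which depends on u only through the mean of log max(u, e^t). *)
Lemma exp_mean_split (u : K -> K) p e b : 0 < e -> continuous u ->
  (forall s, Num.max (u s) e <= expR b) ->
  let x s := ln (Num.max (u s) e) in
  exists g : mK -> \bar K, [/\ measurable_fun [set: mK] g,
    forall t, (0 <= g t)%E,
    (forall t, ln e <= t -> g t = (p ^+ 2 * expR (p * t) *
       (\int[leb]_(s in `[0%R, tau]) ln (Num.max (u s) (expR t)) - t * tau))%R%:E) &
    (\int[leb]_(t in `[ln e, b]) g t =
     (\int[leb]_(s in `[0%R, tau]) (expR (p * x s)) - expR (p * ln e) *
        (p * (\int[leb]_(s in `[0%R, tau]) x s - ln e * tau) + tau))%R%:E)%E].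
Proof.
move=> e0 cu ub x.
have cx : continuous x by exact: continuous_lnmax.
pose f (y : mK * mK) : \bar K :=
  (p ^+ 2 * expR (p * y.2) * (Num.max (x y.1) y.2 - y.2))%:E.
have f0 y : (0 <= f y)%E.
  rewrite lee_fin; apply: mulr_ge0; first by rewrite mulr_ge0 ?sqr_ge0 ?expR_ge0.
  by rewrite subr_ge0 le_max lexx orbT.
have mf : measurable_fun [set: mK * mK] f.
  have mx : measurable_fun [set: mK * mK] (fun y : mK * mK => x y.1).
    have mx1 : measurable_fun [set: mK] x := continuous_measurable_fun cx.
    exact: (measurableT_comp mx1).
  apply/measurable_EFinP; apply: measurable_funM.
    apply: measurable_funM => //; apply: (measurableT_comp (@measurable_expR K)).
    exact: measurable_funM.
  by apply: measurable_funB => //; apply: measurable_maxr.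
have xa s : ln e <= x s.
  by rewrite ler_ln ?posrE// ?lt_max ?e0 ?orbT// le_max lexx orbT.
have xb s : x s <= b.
  by rewrite -(expRK b) ler_ln ?posrE ?expR_gt0// lt_max e0 orbT.
have clm t : continuous (fun s => ln (Num.max (u s) (expR t))).
  by apply: continuous_lnmax => //; exact: expR_gt0.
exists (fun t => \int[leb]_(s in `[0%R, tau]) f (s, t))%E; split.
- exact: measurable_integral_in.
- by move=> t; exact: integral_ge0.
- move=> t et; rewrite /f/=.
  under eq_integral do rewrite max_lnmax//.
  have c1 : continuous (fun s => ln (Num.max (u s) (expR t)) - t).
    by move=> s; apply: cvgB; [exact: clm|exact: cvg_cst].
  rewrite (EFin_Rintegral 0 tau (h := fun s => p ^+ 2 * expR (p * t) *
    (ln (Num.max (u s) (expR t)) - t))); last first.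
    by move=> s; apply: cvgM; [exact: cvg_cst|exact: c1].
  rewrite RintegralZl//; last exact: continuous_integrable.
  rewrite RintegralB//; [by rewrite Rintegral_circ_cst|exact: continuous_integrable|].
  exact: integrable_circ_cst.
rewrite -tonelli_in//.
under eq_integral do rewrite /f/= integral_exp_hinge//.
have c2 : continuous (fun s => expR (p * x s)).
  move=> s; apply: (@continuous_comp _ _ _ (fun s => p * x s) (@expR K)).
    by apply: cvgM; [exact: cvg_cst|exact: cx].
  exact: continuous_expR.
have c3 : continuous (fun s => x s - ln e).
  by move=> s; apply: cvgB; [exact: cx|exact: cvg_cst].
have c4 : continuous (fun s => p * (x s - ln e)).
  by move=> s; apply: cvgM; [exact: cvg_cst|exact: c3].
have c5 : continuous (fun s => p * (x s - ln e) + 1).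
  by move=> s; apply: cvgD; [exact: c4|exact: cvg_cst].
have c6 : continuous (fun s => expR (p * ln e) * (p * (x s - ln e) + 1)).
  by move=> s; apply: cvgM; [exact: cvg_cst|exact: c5].
rewrite (EFin_Rintegral 0 tau (h := fun s => expR (p * x s) -
   expR (p * ln e) * (p * (x s - ln e) + 1))); last first.
  by move=> s; apply: cvgB; [exact: c2|exact: c6].
have i1 := integrable_circ_cst (1 : K).
have ie := integrable_circ_cst (ln e).
rewrite RintegralB//; [|exact: continuous_integrable|exact: continuous_integrable].
rewrite RintegralZl//; last exact: continuous_integrable.
rewrite RintegralD//; last exact: continuous_integrable.
rewrite RintegralZl//; last exact: continuous_integrable.
rewrite RintegralB//; last exact: continuous_integrable.
by rewrite !Rintegral_circ_cst mul1r.
Qed.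

(** Compare the powers truncated below at e by exp_mean_split, whose affine part
    has positive slope in the mean of log max(u, e), and let e tend to 0. *)
Lemma power_mean_of_logmax (u v : K -> K) p M : 0 < p ->
  continuous u -> continuous v ->
  (forall s, 0 <= u s <= M) -> (forall s, 0 <= v s <= M) ->
  (forall t, 0 < t -> \int[leb]_(s in `[0%R, tau]) ln (Num.max (u s) t) <=
                      \int[leb]_(s in `[0%R, tau]) ln (Num.max (v s) t)) ->
  \int[leb]_(s in `[0%R, tau]) u s `^ p <= \int[leb]_(s in `[0%R, tau]) v s `^ p.
Proof.
move=> p0 cu cv hu hv huv.
have u0 s : 0 <= u s by case/andP: (hu s).
have v0 s : 0 <= v s by case/andP: (hv s).
have cup := continuous_powR_comp p0 u0 cu.
have cvp := continuous_powR_comp p0 v0 cv.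
have M0 : 0 <= M by case/andP: (hu 0) => /le_trans h /h.
have ep (y e : K) : 0 < e -> expR (p * ln (Num.max y e)) = Num.max y e `^ p.
  by move=> e0; rewrite /powR gt_eqF// lt_max e0 orbT.
have trunc e : 0 < e ->
  \int[leb]_(s in `[0%R, tau]) expR (p * ln (Num.max (u s) e)) <=
  \int[leb]_(s in `[0%R, tau]) expR (p * ln (Num.max (v s) e)).
  move=> e0; pose b := ln (M + e).
  have eb : expR b = M + e by rewrite lnK// posrE ltr_wpDl.
  have ub s : Num.max (u s) e <= expR b.
    rewrite eb ge_max lerDr M0 andbT.
    by case/andP: (hu s) => _ /le_trans; apply; rewrite lerDl ltW.
  have vb s : Num.max (v s) e <= expR b.
    rewrite eb ge_max lerDr M0 andbT.
    by case/andP: (hv s) => _ /le_trans; apply; rewrite lerDl ltW.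
  have [gu [mgu gu0 gue gui]] := exp_mean_split p e0 cu ub.
  have [gv [mgv gv0 gve gvi]] := exp_mean_split p e0 cv vb.
  have : (\int[leb]_(t in `[ln e, b]) gu t <= \int[leb]_(t in `[ln e, b]) gv t)%E.
    apply: ge0_le_integral => //.
    - exact: measurable_funTS mgu.
    - exact: measurable_funTS mgv.
    move=> t /=; rewrite in_itv/= => /andP[et _].
    rewrite gue// gve// lee_fin; apply: ler_wpM2l.
      by rewrite mulr_ge0 ?sqr_ge0 ?expR_ge0.
    by rewrite lerD2r huv// expR_gt0.
  rewrite gui gvi lee_fin => h.
  have := huv _ e0.
  have := expR_ge0 (p * ln e).
  move: h.
  set Eu := \int[leb]_(s in _) expR _; set Ev := \int[leb]_(s in _) expR _.
  set Lu := \int[leb]_(s in _) ln _; set Lv := \int[leb]_(s in _) ln _.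
  move: (expR _) => c h c0 L.
  have : c * (p * (Lu - Lv)) <= 0.
    by rewrite mulr_ge0_le0// mulr_ge0_le0 ?subr_le0// ltW.
  move: (2 * pi) Eu Ev Lu Lv h L => T Eu Ev Lu Lv h L h2.
  rewrite -subr_ge0.
  have -> : Ev - Eu = (Ev - c * (p * (Lv - ln e * T) + T) -
    (Eu - c * (p * (Lu - ln e * T) + T))) - c * (p * (Lu - Lv)) by ring.
  by rewrite addr_ge0 ?subr_ge0// oppr_ge0.
apply/ler_addgt0Pr => d d0.
have dt : 0 < d / tau by rewrite divr_gt0 ?tau_gt0.
pose e := (d / tau) `^ p^-1.
have e0 : 0 < e by rewrite powR_gt0.
have ee : e `^ p = d / tau by rewrite -powRrM mulVf ?gt_eqF// powRr1// ltW.
have cm (w : K -> K) : continuous w ->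
    continuous (fun s => expR (p * ln (Num.max (w s) e))).
  move=> cw s; apply: (@continuous_comp _ _ _ (fun s => p * ln (Num.max (w s) e)) (@expR K)).
    by apply: cvgM; [exact: cvg_cst|exact: continuous_lnmax].
  exact: continuous_expR.
have iu := continuous_integrable 0 tau (cm _ cu).
have iv := continuous_integrable 0 tau (cm _ cv).
have iup := continuous_integrable 0 tau cup.
have ivp := continuous_integrable 0 tau cvp.
apply: (@le_trans _ _ (\int[leb]_(s in `[0%R, tau]) expR (p * ln (Num.max (u s) e)))).
  apply: le_Rintegral => // s _.
  rewrite ep// ge0_ler_powR ?(ltW p0)// ?nnegrE// ?le_max ?u0 ?lexx//.
apply: (le_trans (trunc _ e0)).
have -> : d = \int[leb]_(s in `[0%R, tau]) (e `^ p).
  by rewrite Rintegral_circ_cst ee divfK// gt_eqF// tau_gt0.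
have ic := integrable_circ_cst (e `^ p).
rewrite -RintegralD//.
apply: le_Rintegral => //.
  have cs : continuous (fun s => v s `^ p + e `^ p).
    by move=> s; apply: cvgD; [exact: cvp|exact: cvg_cst].
  exact: continuous_integrable.
move=> s _; rewrite ep//.
by have [h|h] := leP (v s) e; rewrite ?lerDl ?lerDr powR_ge0.
Qed.

Lemma power_mean_mulop n (e : nat -> K[i]) P p : 0 < p -> zero_free_open (symbol n e) ->
  e 0%N = 1 -> (size P <= n.+1)%N ->
  \int[leb]_(s in `[0%R, tau]) circ_abs (mulop n e P) s `^ p <=
  \int[leb]_(s in `[0%R, tau]) circ_abs P s `^ p.
Proof.
move=> p0 he e0 sP.
have [M1 M10 h1] := circ_abs_bounded P.
have [M2 M20 h2] := circ_abs_bounded (mulop n e P).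
apply: (@power_mean_of_logmax _ _ _ (M1 + M2)) => //.
- exact: continuous_circ_abs.
- exact: continuous_circ_abs.
- by move=> s; rewrite circ_abs_ge0 (le_trans (h2 s))// lerDr ltW.
- by move=> s; rewrite circ_abs_ge0 (le_trans (h1 s))// lerDl ltW.
by move=> t t0; exact: logmax_mean_mulop.
Qed.

End PowerMeans.

(** * A multiplier together with its dual *)

Section MeanIneq.
Variable K : realType.
Notation leb := (@lebesgue_measure K).
Notation tau := (2 * pi : K)%R.
Notation mK := (measurableTypeR K).
Implicit Types (a b w : K[i]) (t p : K) (F G P : {poly K[i]}).
Hint Resolve measurable_circ : core.

Definition binom_pow p a b t : K := normc (a + b * cexpi t) `^ p.

Lemma binom_pow_continuous p a b : 0 < p -> continuous (binom_pow p a b).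
Proof.
move=> p0; apply: continuous_powR_comp => //; first by move=> t; exact: normc_ge0.
apply: continuous_normc; apply: ccontinuousD; first exact: ccontinuous_cst.
by apply: ccontinuousM; [exact: ccontinuous_cst|exact: ccontinuous_cexpi].
Qed.

Lemma binom_pow_period p a b t : binom_pow p a b (t + tau) = binom_pow p a b t.
Proof. by rewrite /binom_pow cexpiD2pi. Qed.

(** Rotation of the circle. *)
Lemma binom_pow_mean_norm p a b : 0 < p ->
  \int[leb]_(t in `[0%R, tau]) binom_pow p a b t =
  \int[leb]_(t in `[0%R, tau]) binom_pow p (normc a)%:C (normc b)%:C t.
Proof.
move=> p0; have [c c2 e] := normc_polar a b.
rewrite -(Rintegral_shift_period c2 (@binom_pow_continuous p a b p0) (binom_pow_period p a b)).
by apply: eq_Rintegral => t _; rewrite /binom_pow mulrC e mulrC.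
Qed.

(** Once the coefficients are replaced by their moduli x >= y, the inequality
    y |1 + e^{it}| <= |x + y e^{it}| holds for every t. *)
Lemma binom_pow_mean_ge p a b : 0 < p -> normc b <= normc a ->
  normc b `^ p * \int[leb]_(t in `[0%R, tau]) binom_pow p 1 1 t <=
  \int[leb]_(t in `[0%R, tau]) binom_pow p a b t.
Proof.
move=> p0 ba; rewrite [leRHS]binom_pow_mean_norm//.
have c1 := @binom_pow_continuous p 1 1 p0.
have cab := @binom_pow_continuous p (normc a)%:C (normc b)%:C p0.
rewrite -RintegralZl//; last exact: continuous_integrable.
apply: le_Rintegral => //; [|exact: continuous_integrable|].
  apply: continuous_integrable => t; apply: cvgM; [exact: cvg_cst|exact: c1].
move=> t _; rewrite /binom_pow -powRM ?normc_ge0// ge0_ler_powR ?(ltW p0)//.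
- by rewrite nnegrE mulr_ge0 ?normc_ge0.
- by rewrite nnegrE normc_ge0.
have b0 := normc_ge0 b; move: (normc a) (normc b) b0 ba => x y y0 yx.
have -> : y * normc (1 + 1 * cexpi t) = normc (y%:C * (1 + cexpi t)).
  by rewrite normcM normc_real ger0_norm// mul1r.
rewrite /cexpi /=.
have cs := cos2Dsin2 t; have cg := cos_geN1 t.
rewrite !mul0r !add0r ?subr0 ?addr0.
apply: ler_wsqrtr.
move: (cos t) (sin t) cs cg => c s cs cg.
have -> : (y * (1 + c)) ^+ 2 + (y * s) ^+ 2 = y ^+ 2 * (1 + 2 * c + (c ^+ 2 + s ^+ 2)) by ring.
have -> : (x + y * c) ^+ 2 + (y * s) ^+ 2 = x ^+ 2 + 2 * x * y * c + y ^+ 2 * (c ^+ 2 + s ^+ 2) by ring.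
rewrite cs -subr_ge0.
have -> : x ^+ 2 + 2 * x * y * c + y ^+ 2 * 1 - y ^+ 2 * (1 + 2 * c + 1) =
  (x - y) * ((x - y) + 2 * y * (1 + c)) by ring.
rewrite mulr_ge0 ?subr_ge0// addr_ge0 ?subr_ge0// mulr_ge0 ?mulr_ge0//; lra.
Qed.

(** Integrating |D + e^{it} T|^p first in t gives the lower bound, because the
    modulus of D dominates; the upper bound is integrated in t after exchanging
    the integrals. *)
Lemma double_mean_ineq (D T : {poly K[i]}) (a b : K[i]) (N p : K) : 0 < p -> 0 <= N ->
  (forall s, circ_abs T s <= circ_abs D s) ->
  (forall t, \int[leb]_(s in `[0%R, tau])
      normc (D.[cexpi s] + T.[cexpi s] * cexpi t) `^ p <= binom_pow p a b t * N) ->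
  \int[leb]_(s in `[0%R, tau]) circ_abs T s `^ p *
    \int[leb]_(t in `[0%R, tau]) binom_pow p 1 1 t <=
  \int[leb]_(t in `[0%R, tau]) binom_pow p a b t * N.
Proof.
move=> p0 N0 TD inner.
set c1 := \int[leb]_(t in _) binom_pow p 1 1 t.
have c10 : 0 <= c1 by apply: Rintegral_ge0 => t _; exact: powR_ge0.
have cT := continuous_powR_comp p0 (circ_abs_ge0 T) (@continuous_circ_abs K T).
have cTc : continuous (fun s => circ_abs T s `^ p * c1).
  by move=> s; apply: cvgM; [exact: cT|exact: cvg_cst].
have cb := @binom_pow_continuous p a b p0.
have cbN : continuous (fun t => binom_pow p a b t * N).
  by move=> t; apply: cvgM; [exact: cb|exact: cvg_cst].
pose f (y : mK * mK) : \bar K := (normc (D.[cexpi y.1] + T.[cexpi y.1] * cexpi y.2) `^ p)%:E.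
have f0 y : (0 <= f y)%E by rewrite lee_fin powR_ge0.
have mf : measurable_fun [set: mK * mK] f.
  apply/measurable_EFinP.
  apply: (measurableT_comp (@measurable_powR K p)).
  apply: measurable_normc; apply: cmeasurableD.
    by apply: cmeasurable_horner; exact: cmeasurable_cexpi.
  by apply: cmeasurableM; [apply: cmeasurable_horner; exact: cmeasurable_cexpi|exact: cmeasurable_cexpi].
have low : (\int[leb]_(s in `[0%R, tau]) (circ_abs T s `^ p * c1)%:E <=
   \int[leb]_(s in `[0%R, tau]) \int[leb]_(t in `[0%R, tau]) f (s, t))%E.
  have eI s : (\int[leb]_(t in `[0%R, tau]) f (s, t) =
     (\int[leb]_(t in `[0%R, tau]) binom_pow p D.[cexpi s] T.[cexpi s] t)%R%:E)%E.
    by rewrite -EFin_Rintegral//; exact: binom_pow_continuous.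
  apply: ge0_le_integral => //.
  - by move=> s _; rewrite lee_fin mulr_ge0 ?powR_ge0.
  - apply/measurable_EFinP/measurable_funTS.
    exact: continuous_measurable_fun cTc.
  - exact: measurable_funTS (measurable_integral_in_r _ mf f0).
  - by move=> s _; rewrite eI lee_fin; apply: binom_pow_mean_ge => //; exact: TD.
have up : (\int[leb]_(t in `[0%R, tau]) \int[leb]_(s in `[0%R, tau]) f (s, t) <=
   \int[leb]_(t in `[0%R, tau]) (binom_pow p a b t * N)%:E)%E.
  apply: ge0_le_integral => //.
  - by move=> t _; exact: integral_ge0.
  - exact: measurable_funTS (measurable_integral_in _ mf f0).
  - apply/measurable_EFinP/measurable_funTS.
    exact: continuous_measurable_fun cbN.
  move=> t _.
  have ct : continuous (fun s => normc (D.[cexpi s] + T.[cexpi s] * cexpi t) `^ p).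
    have -> : (fun s => normc (D.[cexpi s] + T.[cexpi s] * cexpi t) `^ p) =
       (fun s => circ_abs (D + cexpi t *: T) s `^ p).
      by apply/funext => s; rewrite /circ_abs hornerD hornerZ mulrC.
    exact: continuous_powR_comp p0 (circ_abs_ge0 _) (@continuous_circ_abs K _).
  by rewrite (EFin_Rintegral 0 tau ct) lee_fin; exact: inner.
have := le_trans low; rewrite tonelli_in// => /(_ _ up).
rewrite (EFin_Rintegral 0 tau cTc) (EFin_Rintegral 0 tau cbN) lee_fin.
rewrite RintegralZr//; last exact: continuous_integrable.
by rewrite RintegralZr//; exact: continuous_integrable.
Qed.

(** For fixed t, dividing d + e^{it} (dual d) by its value at 0 gives a multiplier
    that fixes constants, and Arestov's inequality applies to it. *)
Lemma power_mean_dual_comb n (d : nat -> K[i]) P p t : 0 < p -> (0 < n)%N ->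
  zero_free_closed (symbol n d) -> (size P <= n.+1)%N ->
  \int[leb]_(s in `[0%R, tau])
     normc ((mulop n d P).[cexpi s] + (mulop n (dual n d) P).[cexpi s] * cexpi t) `^ p <=
  binom_pow p (d 0%N) (dual n d 0%N) t * \int[leb]_(s in `[0%R, tau]) circ_abs P s `^ p.
Proof.
move=> p0 n0 hd sP.
pose mu := cexpi t; have mu1 : `|mu| <= 1 by rewrite norm_cexpi.
pose de k := d k + mu * dual n d k.
have hde : zero_free_open (symbol n de) by exact: symbol_dual_comb.
have de0 : de 0%N != 0.
  have := hde 0; rewrite normr0 ltr01 horner_coef0 coef_poly/= bin0 mul1r.
  by apply.
pose e k := (de 0%N)^-1 * de k.
have he : zero_free_open (symbol n e).
  have -> : symbol n e = (de 0%N)^-1 *: symbol n de.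
    apply/polyP => k; rewrite coefZ !coef_poly; case: ifP => _; last by rewrite mulr0.
    by rewrite /e mulrCA.
  by move=> z z1; rewrite hornerZ mulf_neq0 ?invr_eq0 ?hde.
have e0 : e 0%N = 1 by rewrite /e mulVf.
have eP : mulop n e P = (de 0%N)^-1 *: (mulop n d P + mu *: mulop n (dual n d) P).
  rewrite -mulop_addl; apply/polyP => k.
  rewrite coefZ !coef_poly; case: ifP => _; last by rewrite mulr0.
  by rewrite /e mulrA.
have pm := power_mean_mulop p0 he e0 sP.
have -> : binom_pow p (d 0%N) (dual n d 0%N) t = normc (de 0%N) `^ p.
  by rewrite /binom_pow /de mulrC.
move: (de 0%N) de0 (mulop n e P) eP pm => c; rewrite -normc_gt0 => c0.
move: (mulop n d P) (mulop n (dual n d) P) => D T Q eQ pm.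
have ef s : normc (D.[cexpi s] + T.[cexpi s] * cexpi t) `^ p =
    normc c `^ p * circ_abs Q s `^ p.
  rewrite -powRM ?normc_ge0//; congr (_ `^ _).
  rewrite eQ /circ_abs hornerZ normcM normcV mulrA divff ?gt_eqF// mul1r.
  by rewrite hornerD hornerZ mulrC.
under eq_Rintegral do rewrite ef.
have cQ := continuous_powR_comp p0 (circ_abs_ge0 Q) (@continuous_circ_abs K Q).
rewrite RintegralZl//; last exact: continuous_integrable.
by rewrite ler_wpM2l// powR_ge0.
Qed.

(** The double integral of |d P + e^{it} (dual d) P|^p is what links the two sides:
    the zero-freeness of P makes the modulus of d P dominate that of (dual d) P on
    the circle, and Arestov's inequality bounds its means at fixed t. *)
Lemma dual_mean_ineq n (d : nat -> K[i]) P p : 0 < p -> (0 < n)%N ->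
  zero_free_closed (symbol n d) -> (size P <= n.+1)%N -> zero_free_open P ->
  \int[leb]_(s in `[0%R, tau]) circ_abs (mulop n (dual n d) P) s `^ p *
    \int[leb]_(t in `[0%R, tau]) binom_pow p 1 1 t <=
  \int[leb]_(t in `[0%R, tau]) binom_pow p (d 0%N) (dual n d 0%N) t *
    \int[leb]_(s in `[0%R, tau]) circ_abs P s `^ p.
Proof.
move=> p0 n0 hd sP hP.
have N0 : 0 <= \int[leb]_(s in `[0%R, tau]) circ_abs P s `^ p.
  by apply: Rintegral_ge0 => s _; exact: powR_ge0.
apply: (double_mean_ineq (D := mulop n d P) p0 N0) => [s|t].
  by rewrite -le_normc; apply: mulop_dual_le => //; rewrite norm_cexpi.
exact: power_mean_dual_comb.
Qed.

Lemma pnormE p F : p != 0 ->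
  pnorm p F = (tau^-1 * \int[leb]_(t in `[0%R, tau]) circ_abs F t `^ p) `^ p^-1.
Proof. by rewrite /pnorm => /negbTE ->. Qed.

Lemma mean_powR_ge0 p F : 0 <= \int[leb]_(t in `[0%R, tau]) circ_abs F t `^ p.
Proof. by apply: Rintegral_ge0 => t _; exact: powR_ge0. Qed.

Lemma mean_powR_binomial p n (a b : K[i]) : 0 < p -> (0 < n)%N ->
  \int[leb]_(t in `[0%R, tau]) circ_abs (b *: 'X^n + a%:P) t `^ p =
  \int[leb]_(t in `[0%R, tau]) binom_pow p (normc a)%:C (normc b)%:C t.
Proof.
move=> p0 n0; rewrite -(binom_pow_mean_norm a b p0).
rewrite -[RHS](Rintegral_mul_period n0 (@binom_pow_continuous p a b p0) (binom_pow_period p a b)).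
apply: eq_Rintegral => t _; rewrite /circ_abs /binom_pow hornerD hornerZ hornerXn hornerC.
by rewrite cexpi_mulrn addrC.
Qed.

(** Arestov's inequality for the multiplier that keeps only the constant term
    gives the lower bound 2 pi. *)
Lemma binom_pow_mean_gt0 p : 0 < p -> 0 < \int[leb]_(t in `[0%R, tau]) binom_pow p 1 1 t.
Proof.
(* this multiplier maps 1 + X to 1, and its symbol is 1 *)
move=> p0; pose e (k : nat) : K[i] := (k == 0%N)%:R.
have b1 : symbol 1 e = 1.
  apply/polyP => -[|[|k]]; rewrite coef_poly coef1//=; last by rewrite mulr0.
  by rewrite bin0 mul1r.
have he : zero_free_open (symbol 1 e) by move=> z _; rewrite b1 hornerC oner_neq0.
have s2 : (size (1 *: 'X + 1%:P : {poly K[i]})%R <= 2)%N.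
  by rewrite scale1r size_XaddC.
have := power_mean_mulop p0 he erefl s2.
have -> : mulop 1 e (1 *: 'X + 1%:P) = 1%:P.
  apply/polyP => -[|[|k]]; rewrite coef_poly !coefE//=.
  - by rewrite /e /=; ring.
  - by rewrite /e /=; ring.
under [X in X <= _ -> _]eq_Rintegral do rewrite /circ_abs hornerC normc1 powR1.
rewrite Rintegral_circ_cst mul1r.
rewrite (_ : \int[leb]_(s in _) _ = \int[leb]_(t in `[0%R, tau]) binom_pow p 1 1 t).
  by apply: lt_le_trans; exact: tau_gt0.
apply: eq_Rintegral => t _; rewrite /circ_abs /binom_pow hornerD hornerZ hornerX hornerC.
by rewrite addrC.
Qed.

End MeanIneq.

(** * The operators B as multipliers *)

Section Operator.
Variable K : realType.
Implicit Types (l alpha y : K[i]) (R r s : K) (P : {poly K[i]}).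

Definition B_multiplier n l0 l1 l2 (k : nat) : K[i] :=
  l0 + l1 * (n%:R / 2) * k%:R + l2 * (n%:R ^+ 2 / 8) * (k%:R * (k%:R - 1)).

Lemma coef_Bop n l0 l1 l2 P k :
  (Bop n l0 l1 l2 P)`_k = B_multiplier n l0 l1 l2 k * P`_k.
Proof.
have f1 : (1`!)%:R = 1 :> K[i] by [].
have f2 : (2`!)%:R = 2 :> K[i] by [].
rewrite /Bop f1 f2 !coefD !coefZ exprZn -[_ * (1^-1 *: _)]scalerAl
  -[_ * (2^-1 *: _)]scalerAl !coefZ coefXM coefXnM !coefZ coef_derivn.
have -> : (if k == 0%N then 0 else 1^-1 * (P^`())`_k.-1) = k%:R * P`_k.
  by case: k => [|k]; rewrite ?mul0r// coef_deriv mulr_natl invr1 mul1r.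
rewrite /B_multiplier; case: k => [|[|k]] /=.
- by rewrite !mulr0; field.
- by rewrite !mulr0; field.
have -> : (2 + (k.+2 - 2))%N = k.+2 by rewrite subnKC.
have -> : k.+2 ^_ 2 = (k.+2 * k.+1)%N by rewrite ffactnS ffactn1.
have -> : P`_k.+2 *+ (k.+2 * k.+1) = (k%:R + 2) * (k%:R + 1) * P`_k.+2.
  have e1 : k.+1%:R = k%:R + 1 :> K[i] by rewrite natr1.
  have e2 : k.+2%:R = k%:R + 2 :> K[i] by rewrite -addn2 natrD.
  by rewrite -[LHS]mulr_natl natrM e1 e2.
have -> : k.+2%:R = k%:R + 2 :> K[i] by rewrite -addn2 natrD.
by field.
Qed.

Lemma coef_dilate s P k : (dilate s P)`_k = s%:C ^+ k * P`_k.
Proof.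
rewrite /dilate comp_polyE; under eq_bigr do rewrite exprZn scalerA.
rewrite -(poly_def (size P) (fun i => P`_i * s%:C ^+ i)) coef_poly mulrC.
by case: ltnP => // h; rewrite nth_default// mulr0.
Qed.

Definition Bdiff_multiplier n l0 l1 l2 alpha R r (k : nat) : K[i] :=
  B_multiplier n l0 l1 l2 k * (R%:C ^+ k - alpha * r%:C ^+ k).

Lemma Bdiff_mulop n l0 l1 l2 alpha R r P : (size P <= n.+1)%N ->
  Bdiff n l0 l1 l2 alpha R r P = mulop n (Bdiff_multiplier n l0 l1 l2 alpha R r) P.
Proof.
move=> sP; apply/polyP => k.
rewrite /Bdiff coefB coefZ !coef_Bop !coef_dilate coef_poly ltnS /Bdiff_multiplier.
by case: leqP => kn; [ring|rewrite (leq_sizeP _ _ sP k)// !mulr0 subrr].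
Qed.

Lemma mulop_dualK n (m : nat -> K[i]) P :
  mulop n (dual n (dual n m)) P = mulop n m P.
Proof.
apply/polyP => k; rewrite !coef_poly ltnS; case: leqP => // kn.
by rewrite /dual subKn// conjCK.
Qed.

Lemma symbol_pow n s :
  symbol n (fun k => s%:C ^+ (n - k)) = (s%:C%:P + 'X) ^+ n :> {poly K[i]}.
Proof.
rewrite exprDn /symbol poly_def; apply: eq_bigr => k _.
by rewrite -polyC_exp mul_polyC -[RHS]scaler_nat scalerA.
Qed.

(** The symbol is (R + x)^n - alpha (r + x)^n, and |r + x| < |R + x| on the
    closed disc because R + r + 2 Re x > 0. *)
Lemma symbol_dilate_zero_free n alpha R r : (0 < n)%N -> `|alpha| <= 1 -> 1 <= r ->
  r < R -> zero_free_closed (symbol n (fun k => R%:C ^+ (n - k) - alpha * r%:C ^+ (n - k))).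
Proof.
move=> n0 a1 r1 rR x x1.
have -> : symbol n (fun k => R%:C ^+ (n - k) - alpha * r%:C ^+ (n - k)) =
    (R%:C%:P + 'X) ^+ n - alpha *: (r%:C%:P + 'X) ^+ n.
  rewrite -!symbol_pow; apply/polyP => k; rewrite coefB coefZ !coef_poly.
  by case: ifP => _; [ring|rewrite mulr0 subrr].
rewrite hornerD hornerN hornerZ !horner_exp !hornerE subr_eq0; apply/eqP => e.
have lt : normc (r%:C + x) < normc (R%:C + x).
  move: x1; rewrite normE -[1]/((1 : K)%:C) lecR.
  case: x {e} => a b; rewrite /normc/= => ab1.
  have ab : a ^+ 2 + b ^+ 2 <= 1.
    by rewrite -(sqr_sqrtr (_ : 0 <= a ^+ 2 + b ^+ 2)) ?addr_ge0 ?sqr_ge0//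
      exprn_ile1// sqrtr_ge0.
  have a1' : -1 <= a by have := sqr_ge0 b; nra.
  rewrite add0r ltr_sqrt; last first.
    by have := sqr_ge0 b; nra.
  nra.
have := congr1 (@normc K) e; rewrite normcM !normcX => {}e.
have a1' : normc alpha <= 1 by rewrite -lecR -normE.
have : normc (r%:C + x) ^+ n < normc (R%:C + x) ^+ n.
  by rewrite ltrXn2r -?lt0n// ?normc_ge0.
by rewrite e ltNge ler_piMl ?exprn_ge0 ?normc_ge0.
Qed.

(** The polynomial (y + X)^n has the coefficients C(n, k) y^(n - k), so the
    symbol of the reversed multiplier at y is B applied to it at 1. *)
Lemma symbol_B_E n l0 l1 l2 y :
  (symbol n (fun k => B_multiplier n l0 l1 l2 (n - k))).[y] =
  (Bop n l0 l1 l2 ((y%:P + 'X) ^+ n)).[1].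
Proof.
have eQ : (y%:P + 'X) ^+ n = \poly_(k < n.+1) ('C(n, k)%:R * y ^+ (n - k)).
  rewrite exprDn poly_def; apply: eq_bigr => k _.
  by rewrite -polyC_exp mul_polyC -[LHS]scaler_nat scalerA.
have -> : Bop n l0 l1 l2 ((y%:P + 'X) ^+ n) =
    \poly_(k < n.+1) (B_multiplier n l0 l1 l2 k * ('C(n, k)%:R * y ^+ (n - k))).
  apply/polyP => k; rewrite coef_Bop eQ !coef_poly.
  by case: ifP; rewrite ?mulr0.
rewrite !horner_poly [RHS](reindex_inj rev_ord_inj) /=.
apply: eq_bigr => k _; rewrite subSS expr1n mulr1.
have kn : (k <= n)%N by rewrite -ltnS.
by rewrite subKn// bin_sub//; ring.
Qed.

(** With q = 1 + y, the value of the symbol is q^n u(n / (2 q)), and the point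
    x0 = n / (2 q) is strictly nearer to n / 2 than to 0 when |y| < 1. *)
Lemma symbol_B_zero_free n l0 l1 l2 : (0 < n)%N -> Bclass n l0 l1 l2 ->
  zero_free_open (symbol n (fun k => B_multiplier n l0 l1 l2 (n - k))).
Proof.
move=> n0 hB y y1; rewrite symbol_B_E; set q := 1 + y.
have q0 : q != 0.
  rewrite /q addr_eq0; apply: contraTneq y1 => e.
  by rewrite -normrN -e normr1 ltxx.
pose x0 := n%:R / 2 / q.
have nn : (n%:R : K[i]) != 0 by rewrite pnatr_eq0 -lt0n.
have ux : (upoly n l0 l1 l2).[x0] != 0.
  apply/negP => /(hB x0).
  have -> : x0 - n%:R / 2 = x0 * (- y) by rewrite /x0 /q; field.
  have x00 : 0 < `|x0|.
    by rewrite normr_gt0 !mulf_neq0 ?invr_eq0// pnatr_eq0.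
  rewrite [`|x0 * _|]normrM normrN => h; have := gtr_pMr `|y| x00.
  by rewrite y1 => /lt_geF; rewrite h.
have -> : (Bop n l0 l1 l2 ((y%:P + 'X) ^+ n)).[1] =
    q ^+ n * (upoly n l0 l1 l2).[x0]; last by rewrite mulf_neq0 ?expf_neq0.
have c2 : ('C(n, 2)%:R : K[i]) = n%:R * (n%:R - 1) / 2.
  have := bin_ffact n 2; rewrite !ffactnS ffactn0 muln1 => /(congr1 (fun k => k%:R : K[i])).
  rewrite !natrM -subn1 natrB// => <-.
  by rewrite mulfK// pnatr_eq0.
pose Q : {poly K[i]} := (y%:P + 'X) ^+ n.
have dQ : Q^`() = (y%:P + 'X) ^+ n.-1 *+ n.
  by rewrite deriv_exp derivD derivC derivX add0r mul1r.
have ddQ : Q^`(2) = ((y%:P + 'X) ^+ n.-2 *+ n.-1) *+ n.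
  rewrite derivnS derivn1 dQ derivMn deriv_exp derivD derivC derivX add0r.
  by rewrite mul1r.
have hq : (y%:P + 'X : {poly K[i]}).[1] = q.
  by rewrite hornerD hornerC hornerX addrC.
have bE : (Bop n l0 l1 l2 Q).[1] = l0 * q ^+ n +
   l1 * (n%:R / 2 * (n%:R * q ^+ n.-1)) +
   l2 * ((n%:R / 2) ^+ 2 * (2^-1 * (n%:R * (n.-1%:R * q ^+ n.-2)))).
  have f1 : (1`!)%:R = 1 :> K[i] by [].
  have f2 : (2`!)%:R = 2 :> K[i] by [].
  rewrite /Bop f1 f2 invr1 scale1r dQ ddQ !hornerD !hornerZ !hornerM !hornerZ.
  have hn k : ((y%:P + 'X : {poly K[i]}) ^+ k).[1] = q ^+ k by rewrite horner_exp hq.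
  rewrite /Q hornerX !hornerMn !hn !mulr1 -expr2.
  have nE (z : K[i]) j : z *+ j = j%:R * z by rewrite mulr_natl.
  by rewrite (nE (q ^+ n.-1) n) (nE (q ^+ n.-2) n.-1) (nE (n.-1%:R * q ^+ n.-2) n).
have uE : (upoly n l0 l1 l2).[x0] =
   l0 + n%:R * l1 * x0 + n%:R * (n%:R - 1) / 2 * l2 * x0 ^+ 2.
  by rewrite /upoly bin1 c2 !hornerD !hornerZ hornerX hornerXn hornerC.
rewrite bE uE /x0; clear -n0 q0 nn.
case: n n0 nn => [//|[|m]] _ nn /=.
  by rewrite expr1 expr0; field.
by rewrite !exprS -[m.+2%:R]natr1 addrK; field; rewrite q0.
Qed.

(** The dual symbol at z is the conjugate of the image of the dilation part
    under the reversed multiplier of B, evaluated at conj z. *)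
Lemma symbol_Bdiff_zero_free n l0 l1 l2 alpha R r : (0 < n)%N ->
  Bclass n l0 l1 l2 -> `|alpha| <= 1 -> 1 <= r -> r < R ->
  zero_free_closed (symbol n (dual n (Bdiff_multiplier n l0 l1 l2 alpha R r))).
Proof.
move=> n0 hB a1 r1 rR.
pose W := symbol n (fun k => R%:C ^+ (n - k) - alpha * r%:C ^+ (n - k)).
have hW : zero_free_closed W by exact: symbol_dilate_zero_free.
have hb := symbol_B_zero_free n0 hB.
have := mulop_zero_free_closed_arg hb (size_poly _ _ : (size W <= n.+1)%N) hW.
set V := mulop _ _ _ => hV z z1.
have -> : (symbol n (dual n (Bdiff_multiplier n l0 l1 l2 alpha R r))).[z] = ((V.[(z^*)%R])^*)%R.
  rewrite !horner_poly rmorph_sum; apply: eq_bigr => k _ /=.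
  rewrite !rmorphM rmorphXn /= conjCK coef_poly ltn_ord /dual /Bdiff_multiplier.
  rewrite !rmorphM /= rmorph_nat; ring.
by rewrite conjC_eq0 hV// norm_conjC.
Qed.

Lemma B_multiplier_lead n l0 l1 l2 : (0 < n)%N ->
  B_multiplier n l0 l1 l2 n = Lam n l0 l1 l2.
Proof. by move=> n0; rewrite /B_multiplier /Lam; field. Qed.

Lemma B_multiplier0 n l0 l1 l2 : B_multiplier n l0 l1 l2 0 = l0.
Proof. by rewrite /B_multiplier; ring. Qed.

Lemma Bdiff_multiplier_lead n l0 l1 l2 alpha R r : (0 < n)%N ->
  Bdiff_multiplier n l0 l1 l2 alpha R r n = (R%:C ^+ n - alpha * r%:C ^+ n) * Lam n l0 l1 l2.
Proof. by move=> n0; rewrite /Bdiff_multiplier B_multiplier_lead// mulrC. Qed.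

Lemma Bdiff_multiplier0 n l0 l1 l2 alpha R r :
  Bdiff_multiplier n l0 l1 l2 alpha R r 0 = (1 - alpha) * l0.
Proof. by rewrite /Bdiff_multiplier B_multiplier0 !expr0 mulr1 mulrC. Qed.

End Operator.

(** * The means of the statement *)

Section Final.
Variable K : realType.
Notation leb := (@lebesgue_measure K).
Notation tau := (2 * pi : K)%R.
Implicit Types (a b x y : K[i]) (p : K) (F G P : {poly K[i]}).

Lemma pnorm_eq p F G : circ_abs F = circ_abs G -> pnorm p F = pnorm p G.
Proof. by rewrite /pnorm => ->. Qed.

Lemma pnorm0_zero_free n G : (size G <= n.+1)%N -> zero_free_open G ->
  pnorm 0 G = normc G.[0].
Proof.
move=> sG hG; have [_ e] := jensen sG hG.
rewrite /pnorm eqxx e -EFinM mulrC mulfK ?gt_eqF ?tau_gt0//=.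
by rewrite lnK// posrE normc_gt0 hG// normr0 ltr01.
Qed.

Lemma pnorm0_le n F G : (size F <= n.+1)%N -> F != 0 ->
  (size G <= n.+1)%N -> G != 0 ->
  (forall t, circ_abs F t <= circ_abs G t) -> pnorm 0 F <= pnorm 0 G.
Proof.
move=> sF F0 sG G0 le; have iF := log_integrable sF F0.
have iG := log_integrable sG G0.
have fF := integrable_fin_num (@measurable_circ K) iF.
have fG := integrable_fin_num (@measurable_circ K) iG.
have : (\int[leb]_(t in `[0%R, tau]) lne (circ_abs F t)%:E <=
   \int[leb]_(t in `[0%R, tau]) lne (circ_abs G t)%:E)%E.
  by apply: le_integral => // t _; apply: le_lne => //; exact: circ_abs_ge0.
rewrite /pnorm eqxx -(fineK fF) -(fineK fG) lee_fin -!EFinM /= ler_expR => h.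
by rewrite ler_pM2l// invr_gt0 tau_gt0.
Qed.

Lemma zero_free_binomial n a b : (0 < n)%N -> a != 0 -> normc b <= normc a ->
  zero_free_open (b *: 'X^n + a%:P).
Proof.
move=> n0 a0 ba z; rewrite -[1]/((1 : K)%:C) normE ltcR => z1.
rewrite hornerD hornerZ hornerXn hornerC addr_eq0; apply/eqP.
move=> /(congr1 (@normc K)); rewrite normcM normcX normcN => e.
have ap : 0 < normc a by rewrite normc_gt0.
have : normc b * normc z ^+ n < normc a.
  have zn : normc z ^+ n < 1 by rewrite exprn_ilt1 ?normc_ge0// -lt0n.
  have [->|b0] := eqVneq b 0; first by rewrite normc0 mul0r.
  by apply: lt_le_trans ba; rewrite gtr_pMr// normc_gt0.
by rewrite e ltxx.
Qed.

Lemma size_binomial n a b : (size (b *: 'X^n + a%:P)%R <= n.+1)%N.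
Proof.
rewrite (leq_trans (size_polyD _ _))// geq_max.
rewrite (leq_trans (size_scale_leq _ _)) ?size_polyXn//.
by rewrite (leq_trans (size_polyC_leq1 _)).
Qed.

Lemma pnorm0_binomial n a b : (0 < n)%N -> (a != 0) || (b != 0) ->
  pnorm 0 (b *: 'X^n + a%:P) = Num.max (normc a) (normc b).
Proof.
move=> n0; have main x y : x != 0 -> normc y <= normc x ->
    pnorm 0 (y *: 'X^n + x%:P) = normc x.
  move=> x0 yx; rewrite (pnorm0_zero_free (size_binomial _ _ _) (zero_free_binomial n0 x0 yx)).
  by rewrite hornerD hornerZ hornerXn hornerC expr0n gtn_eqF// mulr0 add0r.
have [ba|ab] := leP (normc b) (normc a) => ab0.
  apply: main => //; rewrite -normc_gt0.
  case/orP: ab0; rewrite -normc_gt0 => // /lt_le_trans; exact.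
rewrite -normc_conj -(@main b^*%C a^*%C).
- apply: pnorm_eq; apply/funext => t.
  rewrite /circ_abs !hornerD !hornerZ !hornerXn !hornerC -!cexpi_mulrn.
  by rewrite addrC normc_cexpi_swap addrC.
- by rewrite -normc_gt0 normc_conj (le_lt_trans (normc_ge0 a)).
- by rewrite !normc_conj ltW.
Qed.

Lemma pnorm_binomialE p n a b : 0 < p -> (0 < n)%N ->
  pnorm p (b *: 'X^n + a%:P) = (tau^-1 *
    \int[leb]_(t in `[0%R, tau]) binom_pow p (normc a)%:C (normc b)%:C t) `^ p^-1.
Proof.
move=> p0 n0; have pn : p != 0 by rewrite gt_eqF.
by rewrite (pnormE _ pn) (mean_powR_binomial _ _ p0 n0).
Qed.

(** The means of a binomial depend only on the moduli of its coefficients: by a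
    change of variable and a rotation for p > 0, by Jensen's formula for p = 0. *)
Lemma pnorm_binomial_scale p n a b x y (rho : K) : 0 <= p -> (0 < n)%N ->
  0 < rho -> normc a = rho -> normc b = rho -> (x != 0) || (y != 0) ->
  pnorm p ((a * y) *: 'X^n + (b * x)%:P) = rho * pnorm p (y *: 'X + x%:P).
Proof.
move=> p0 n0 r0 ar br xy0.
have a0 : a != 0 by rewrite -normc_gt0 ar.
have b0 : b != 0 by rewrite -normc_gt0 br.
rewrite -['X]expr1; move: p0; rewrite le_eqVlt => /predU1P[<-|p0].
  rewrite !pnorm0_binomial//; last by rewrite !mulf_eq0 !negb_or a0 b0.
  by rewrite !normcM ar br maxr_pMr// ltW.
have pn : p != 0 by rewrite gt_eqF.
rewrite !pnorm_binomialE// !normcM ar br.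
have e t : binom_pow p (rho * normc x)%:C (rho * normc y)%:C t =
    rho `^ p * binom_pow p (normc x)%:C (normc y)%:C t.
  rewrite /binom_pow -powRM ?normc_ge0 ?(ltW r0)//; congr (_ `^ _).
  have er : rho = normc rho%:C by rewrite normc_real gtr0_norm.
  rewrite [X in _ = X * _]er -normcM; congr normc.
  by rewrite mulrDr mulrA !rmorphM.
under eq_Rintegral do rewrite e.
rewrite RintegralZl//; last by apply: continuous_integrable; exact: binom_pow_continuous.
rewrite mulrCA powRM ?powR_ge0//.
  by rewrite -powRrM mulfV// powRr1// ltW.
rewrite mulr_ge0 ?invr_ge0 ?(ltW (tau_gt0 _))//.
by apply: Rintegral_ge0 => t _; exact: powR_ge0.
Qed.

Lemma pnorm_1X_gt0 p : 0 <= p -> 0 < pnorm p (1 + 'X : {poly K[i]}).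
Proof.
have -> : 1 + 'X = 1 *: 'X^1 + 1%:P :> {poly K[i]}.
  by rewrite scale1r expr1 addrC.
rewrite le_eqVlt => /predU1P[<-|p0].
  by rewrite pnorm0_binomial ?oner_neq0// normc1 maxxx.
have pn : p != 0 by rewrite gt_eqF.
rewrite pnorm_binomialE// normc1.
by rewrite powR_gt0// mulr_gt0 ?invr_gt0 ?tau_gt0// binom_pow_mean_gt0.
Qed.

Lemma le_div_mul (u v w x : K) : 0 < v -> u * v <= w * x -> u <= w / v * x.
Proof. by move=> v0; rewrite -ler_pdivlMr// mulrAC. Qed.

Lemma scale_div_mul (u v w : K) : 0 < v -> u * w = w / v * (u * v).
Proof. by move=> v0; field; rewrite gt_eqF. Qed.

Lemma pnorm_mulop_le n (m : nat -> K[i]) P p : 0 <= p -> (0 < n)%N ->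
  zero_free_closed (symbol n (dual n m)) -> size P = n.+1 -> zero_free_open P ->
  pnorm p (mulop n m P) <=
    pnorm p (m n *: 'X + (m 0%N)%:P) / pnorm p (1 + 'X) * pnorm p P.
Proof.
move=> p0 n0 hd sP hP; have c0 := pnorm_1X_gt0 p0.
have sP' : (size P <= n.+1)%N by rewrite sP.
have d0 : dual n m 0 != 0.
  have := hd 0; rewrite normr0 ler01 horner_coef0 coef_poly/= bin0 mul1r.
  by apply.
have ed0 : normc (dual n m 0) = normc (m n) by rewrite /dual subn0 normc_conj.
have mn0 : m n != 0 by rewrite -normc_gt0 -ed0 normc_gt0.
have P0 : P != 0 by rewrite -size_poly_eq0 sP.
apply: (le_div_mul c0).
have e1X : 1 + 'X = 1 *: 'X^1 + 1%:P :> {poly K[i]} by rewrite scale1r expr1 addrC.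
have eX : m n *: 'X + (m 0%N)%:P = m n *: 'X^1 + (m 0%N)%:P by rewrite expr1.
rewrite e1X eX {e1X eX}.
have := p0; rewrite le_eqVlt => /predU1P[<-|{}p0].
  rewrite !pnorm0_binomial ?mn0 ?oner_neq0 ?orbT// normc1 maxxx mulr1.
  have hD := mulop_zero_free_closed hd sP' hP.
  have sD := size_mulop n (dual n m) P.
  apply: (@le_trans _ _ (pnorm 0 (mulop n (dual n m) P))).
    apply: (pnorm0_le (size_mulop n m P) _ sD).
    - apply: contra_neq mn0 => /polyP/(_ n); rewrite coef_poly ltnSn coef0.
      move/eqP; rewrite mulf_eq0 => /orP[/eqP//|].
      by rewrite -[n]/(n.+1.-1) -sP -/(lead_coef P) lead_coef_eq0 (negbTE P0).
    - have := hD 0; rewrite normr0 ler01 => /(_ isT); apply: contra_neq => ->.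
      by rewrite horner0.
    move=> t; rewrite -mulop_dualK; move: t; apply: circ_abs_le => z z1.
    exact: mulop_dual_le.
  rewrite (pnorm0_zero_free sD (zero_free_closed_open hD)) horner_mulop0 normcM ed0.
  rewrite (pnorm0_zero_free sP' hP) ler_wpM2r ?normc_ge0// le_max lexx orbT//.
have pn : p != 0 by rewrite gt_eqF.
rewrite (pnorm_binomialE 1 1 p0 (ltn0Sn 0)) (pnorm_binomialE (m 0) (m n) p0 (ltn0Sn 0)).
rewrite (pnormE (mulop n m P) pn) (pnormE P pn) (@normc1 K) (rmorph1 (real_complex K)).
have := dual_mean_ineq p0 n0 hd sP' hP; rewrite mulop_dualK.
rewrite (binom_pow_mean_norm (dual n m 0) (dual n (dual n m) 0) p0) ed0.
have -> : normc (dual n (dual n m) 0) = normc (m 0%N).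
  by rewrite /dual subn0 subnn !normc_conj.
have -> : \int[leb]_(t in `[0%R, tau]) binom_pow p (normc (m n))%:C (normc (m 0%N))%:C t =
   \int[leb]_(t in `[0%R, tau]) binom_pow p (normc (m 0%N))%:C (normc (m n))%:C t.
  by apply: eq_Rintegral => t _; rewrite /binom_pow normc_cexpi_swap !conjc_real.
have b0 u v : 0 <= \int[leb]_(t in `[0%R, tau]) binom_pow p u v t.
  by apply: Rintegral_ge0 => t _; exact: powR_ge0.
have := mean_powR_ge0 p (mulop n m P); have := mean_powR_ge0 p P.
have := b0 1 1; have := b0 (normc (m 0%N))%:C (normc (m n))%:C.
move: (\int[leb]_(t in _) binom_pow p (normc (m 0%N))%:C (normc (m n))%:C t) => Im.
move: (\int[leb]_(t in _) binom_pow p 1 1 t) => I1.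
move: (\int[leb]_(t in _) circ_abs P t `^ p) => IP.
move: (\int[leb]_(t in _) circ_abs (mulop n m P) t `^ p) => IT.
have t0 : 0 <= tau^-1 by rewrite invr_ge0 ltW ?tau_gt0.
move: (tau^-1) t0 => u u0 Im0 I10 IP0 IT0 h.
rewrite -!powRM ?mulr_ge0//.
rewrite ge0_ler_powR ?nnegrE ?invr_ge0 ?mulr_ge0 ?(ltW p0)//.
by rewrite mulrACA [leRHS]mulrACA ler_wpM2l ?mulr_ge0.
Qed.

End Final.

Theorem corollary1p1 (K : realType) (n : nat) (l0 l1 l2 alpha : K[i])
    (R r p : K) :
  (1 <= n)%N ->
  Bclass n l0 l1 l2 ->
  `|alpha| <= 1 ->
  1 <= r -> r < R ->
  0 <= p ->
  [/\
    (* the inequality *)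
    forall P : {poly K[i]}, poly_deg n P -> zero_free_disc P ->
      pnorm p (Bdiff n l0 l1 l2 alpha R r P)
      <= sharp_const n l0 l1 l2 alpha R r p * pnorm p P,
    (* best possible: no smaller constant works *)
    forall c : K,
      (forall P : {poly K[i]}, poly_deg n P -> zero_free_disc P ->
         pnorm p (Bdiff n l0 l1 l2 alpha R r P) <= c * pnorm p P) ->
      sharp_const n l0 l1 l2 alpha R r p <= c
    & (* equality case *)
    forall a b : K[i], `|a| = `|b| -> `|b| != 0 ->
      pnorm p (Bdiff n l0 l1 l2 alpha R r (a *: 'X^n + b%:P))
      = sharp_const n l0 l1 l2 alpha R r p * pnorm p (a *: 'X^n + b%:P)].
Proof.
move=> n1 hB a1 r1 rR p0.
have hd := symbol_Bdiff_zero_free n1 hB a1 r1 rR.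
set m := Bdiff_multiplier n l0 l1 l2 alpha R r in hd.
have sharpE : sharp_const n l0 l1 l2 alpha R r p =
    pnorm p (m n *: 'X + (m 0%N)%:P) / pnorm p (1 + 'X).
  have -> : m n = (R%:C ^+ n - alpha * r%:C ^+ n) * Lam n l0 l1 l2.
    exact: Bdiff_multiplier_lead.
  have -> : m 0%N = (1 - alpha) * l0 by exact: Bdiff_multiplier0.
  by [].
have BE (P : {poly K[i]}) : (size P <= n.+1)%N -> Bdiff n l0 l1 l2 alpha R r P = mulop n m P.
  exact: Bdiff_mulop.
clearbody m.
have c0 := @pnorm_1X_gt0 K p p0.
have mn0 : m n != 0.
  have := hd 0; rewrite normr0 ler01 horner_coef0 coef_poly/= bin0 mul1r.
  by rewrite /dual subn0 conjC_eq0; apply.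
have equality (a b : K[i]) : `|a| = `|b| -> `|b| != 0 ->
    pnorm p (Bdiff n l0 l1 l2 alpha R r (a *: 'X^n + b%:P))
    = sharp_const n l0 l1 l2 alpha R r p * pnorm p (a *: 'X^n + b%:P).
  rewrite !normE => /complexI ab; rewrite -normE normr_eq0 -normc_gt0 => b0.
  rewrite (BE _ (size_binomial n b a)).
  have -> : mulop n m (a *: 'X^n + b%:P) = (a * m n) *: 'X^n + (b * m 0%N)%:P.
    rewrite mulopD mulopC mulopZ [m 0%N * b]mulrC; congr (_ + _).
    rewrite -scalerA; congr (_ *: _); apply/polyP => k.
    rewrite coef_poly coefZ coefXn ltnS.
    case: (eqVneq k n) => [->|_]; first by rewrite leqnn.
    by rewrite !mulr0; case: ifP.
  have xy : (m 0%N != 0) || (m n != 0) by rewrite mn0 orbT.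
  have e1 := @pnorm_binomial_scale K p n a b _ _ _ p0 n1 b0 ab erefl xy.
  have one : ((1 : K[i]) != 0) || ((1 : K[i]) != 0) by rewrite oner_neq0.
  have e2 := @pnorm_binomial_scale K p n a b _ _ _ p0 n1 b0 ab erefl one.
  rewrite !mulr1 scale1r polyC1 ['X + 1]addrC in e2.
  rewrite e1 e2 sharpE.
  exact: (scale_div_mul _ _ c0).
split; [|move=> c hc|exact: equality].
  move=> P sP hP; have sP' : (size P <= n.+1)%N by rewrite sP.
  rewrite (BE _ sP') sharpE.
  exact: (pnorm_mulop_le p0 n1 hd sP hP).
have nb : `|(1 : K[i])| != 0 by rewrite normr1 oner_neq0.
have eq1 := equality 1 1 erefl nb.
have sX : size (1 *: 'X^n + 1%:P : {poly K[i]}) = n.+1.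
  by rewrite scale1r polyC1 size_XnaddC.
have hX : zero_free_disc (1 *: 'X^n + 1%:P : {poly K[i]}).
  by apply: zero_free_binomial => //; exact: oner_neq0.
have hcX := hc _ sX hX; rewrite eq1 in hcX.
have one : ((1 : K[i]) != 0) || ((1 : K[i]) != 0) by rewrite oner_neq0.
have e2 := @pnorm_binomial_scale K p n 1 1 1 1 1 p0 n1 ltr01 (@normc1 K) (@normc1 K) one.
rewrite !mulr1 !mul1r [1 *: 'X]scale1r polyC1 ['X + 1]addrC in e2.
by move: hcX; rewrite polyC1 e2 (ler_pM2r c0).
Qed.
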